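(* Let $n\ge2$, let $\mu$ be a locally finite Borel measure on $\mathbb{R}^n$, let $1\le q\le\frac{n}{n-1}$ and $\alpha=n-q(n-1)$. Then there is a constant $C>0$ depending only on $n$ and $q$ such that for all $u\in\mathrm{Lip}_c(\mathbb{R}^n)$, $$\|u\|_{L^{q,1}(\mu)}\le C\int_{\mathbb{R}^n}|\nabla u|\,(\mathrm{M}_\alpha\mu)^{\frac1q}\,dx.$$
   Context: A locally finite Borel measure on $\mathbb{R}^n$ is a positive Borel measure $\mu$ with $\mu(K)<\infty$ for every compact $K$. $\mathcal{L}$ denotes Lebesgue measure. For $0\le\alpha<n$, $\mathrm{M}_\alpha\mu(x)=\sup_{r>0} r^\alpha\,\mu(B_r(x))/\mathcal{L}(B_r(x))\in[0,\infty]$. $\mathrm{Lip}_c(\mathbb{R}^n)$ is the space of compactly supported Lipschitz functions. The Lorentz norm is $\|u\|_{L^{q,1}(\mu)}=q\int_0^\infty\mu(\{x:|u(x)|>t\})^{1/q}\,dt$. In integrals $0\cdot\infty=0$. *)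

(* Defs.v *)
From HB Require Import structures.
From mathcomp Require Import all_boot all_order all_algebra.
From mathcomp Require Import all_classical all_reals all_analysis measurable_realfun.

Set Implicit Arguments.
Unset Strict Implicit.
Unset Printing Implicit Defensive.

Import Order.TTheory GRing.Theory Num.Theory.
Import numFieldNormedType.Exports.

Local Open Scope classical_set_scope.
Local Open Scope ring_scope.

(* R^n is 'rV[R]_n. The library norm and metric on 'rV[R]_n are the sup ones:
   they give the right topology, but Euclidean lengths and balls must be
   written with enorm and eball below. *)
Notation borel_rV R n := (g_sigma_algebraType (@open 'rV[R]_n)).

Section measurable_rV.
Context d (T : measurableType d) (R : realType) (n : nat).

Lemma open_rV_bigcup_rat (U : set 'rV[R]_n) : open U ->
  U = \bigcup_(p in [set p : 'rV[rat]_n * rat |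
                      ball (map_mx ratr p.1 : 'rV[R]_n) (ratr p.2) `<=` U])
        ball (map_mx ratr p.1 : 'rV[R]_n) (ratr p.2).
Proof.
move=> oU; apply/seteqP; split=> [x Ux|x [p /= pU]]; last exact: pU.
have : nbhs x U by rewrite nbhsE /=; exists U.
rewrite -nbhs_ballE => -[e /= e0 xeU].
have [r] : exists r : rat, (ratr r : R) \in `]0, e / 2[.
  by have /rat_in_itvoo[r] : 0 < e / 2 by [rewrite divr_gt0//]; exists r.
rewrite in_itv/= => /andP[r0 re].
have /choice[q qP] : forall i : 'I_n, exists q : rat,
    `|x ord0 i - ratr q| < ratr r.
  move=> i; have /rat_in_itvoo[q] : x ord0 i < x ord0 i + ratr r.
    by rewrite ltrDl.
  rewrite in_itv/= => /andP[xq qx]; exists q.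
  by rewrite ltr0_norm ?subr_lt0// opprB ltrBlDl.
have xq : ball (map_mx ratr (\row_i q i) : 'rV[R]_n) (ratr r) x.
  by split=> // i j; rewrite !mxE (ord1 i) /ball/= distrC.
exists (\row_i q i, r) => //= y qy; apply: xeU; rewrite [e]splitr.
by apply: (@le_ball _ _ x (ratr r + ratr r)); [rewrite lerD// ltW|
  exact: ball_triangle (ball_sym xq) qy].
Qed.

Lemma measurable_fun_rV (f : T -> borel_rV R n) :
  (forall i, measurable_fun setT (fun t => (f t : 'rV[R]_n) ord0 i)) ->
  measurable_fun setT f.
Proof.
move=> mf.
apply: (@measurability _ _ T (borel_rV R n) setT f (@open 'rV[R]_n)) => //.
move=> _ [U oU <-]; rewrite setTI (open_rV_bigcup_rat oU) preimage_bigcup.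
rewrite bigcup_mkcond; apply: countable_bigcupT_measurable => // p.
case: ifPn => // _.
have [p0|p0] := leP (ratr p.2 : R) 0.
  rewrite (_ : _ @^-1` _ = set0)//; apply/seteqP; split=> // t [+ _].
  by rewrite ltNge p0.
rewrite (_ : _ @^-1` _ = \bigcap_(i in [set: 'I_n])
    ((fun t => (f t : 'rV[R]_n) ord0 i) @^-1`
       ball (ratr (p.1 ord0 i) : R) (ratr p.2))).
  apply: fin_bigcap_measurable => // i _.
  rewrite -[X in measurable X]setTI; apply: mf => //.
  exact: measurable_ball.
apply/seteqP; split=> t /=.
  by move=> [_ tp] i /= _; have := tp ord0 i; rewrite mxE.
by move=> tp; split=> // i j; rewrite mxE (ord1 i); exact: tp.
Qed.

End measurable_rV.

Definition rcons_rV (R : realType) (n : nat) (p : borel_rV R n * R) :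
  borel_rV R n.+1 :=
  \row_(i < n.+1) oapp (fun j => (p.1 : 'rV[R]_n) ord0 j) p.2
                       (unlift ord_max i).

Lemma continuous_measurable_rV (R : realType) (n : nat) (f : 'rV[R]_n -> R) :
  continuous f -> measurable_fun setT (f : borel_rV R n -> R).
Proof.
move=> /continuousP cf; apply: (measurability _ (RGenOpens.measurableE R)).
move=> _ [_ [a [b ->] <-]]; rewrite setTI.
by apply: sub_sigma_algebra; apply: cf; exact: interval_open.
Qed.

Lemma measurable_rcons_rV (R : realType) (n : nat) :
  measurable_fun setT (@rcons_rV R n).
Proof.
apply: measurable_fun_rV => i; rewrite /rcons_rV.
under eq_fun do rewrite mxE.
case: unliftP => [j|] _ /=; last exact: measurable_snd.
apply: (measurableT_comp (f := fun v : borel_rV R n => (v : 'rV[R]_n) ord0 j)).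
  by apply: continuous_measurable_rV; exact: coord_continuous.
exact: measurable_fst.
Qed.

(* Lebesgue measure on the Borel sets of R^n: the n-fold product of
   lebesgue_measure, carried to 'rV[R]_n along
   ((x_0 .. x_(n-1)), x_n) |-> (x_0 .. x_n). *)
Fixpoint lebesgue_rV (R : realType) (n : nat) : set (borel_rV R n) -> \bar R :=
  match n with
  | 0 => @dirac _ (borel_rV R 0) (0 : 'rV[R]_0) R
  | m.+1 => pushforward (@lebesgue_rV R m \x (@lebesgue_measure R))%E
              (@rcons_rV R m)
  end.
Arguments lebesgue_rV : clear implicits.

Section lebesgue_rV_measure.
Context (R : realType).
Local Open Scope ereal_scope.

Let lebesgue_rV_is_measure n :
  exists m : {measure set (borel_rV R n) -> \bar R}, lebesgue_rV R n = m.
Proof.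
elim: n => [|n [m mE]]; first by exists (@dirac _ (borel_rV R 0) (0%R : 'rV[R]_0) R).
unshelve (eexists (pushforward (m \x (@lebesgue_measure R)) (@rcons_rV R n))).
  exact: measurable_rcons_rV.
by rewrite /= mE.
Qed.

Let lebesgue_rV0 n : lebesgue_rV R n set0 = 0.
Proof. by have [m ->] := lebesgue_rV_is_measure n; exact: measure0. Qed.

Let lebesgue_rV_ge0 n A : 0 <= lebesgue_rV R n A.
Proof. by have [m ->] := lebesgue_rV_is_measure n; exact: measure_ge0. Qed.

Let lebesgue_rV_sigma_additive n : semi_sigma_additive (lebesgue_rV R n).
Proof.
have [m ->] := lebesgue_rV_is_measure n; exact: measure_semi_sigma_additive.
Qed.

HB.instance Definition _ n := isMeasure.Build _ _ _ (lebesgue_rV R n)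
  (lebesgue_rV0 n) (@lebesgue_rV_ge0 n) (@lebesgue_rV_sigma_additive n).

Lemma lebesgue_rV_box n (a b : 'rV[R]_n) :
  (forall i, (a ord0 i <= b ord0 i)%R) ->
  lebesgue_rV R n
    [set v : 'rV[R]_n | forall i, (v ord0 i \in `[a ord0 i, b ord0 i])%R] =
  (\prod_(i < n) (b ord0 i - a ord0 i))%:E.
Proof.
elim: n a b => [a b _|n IH a b ab].
  by rewrite big_ord0 /= diracE mem_set//= => -[].
pose w i : 'I_n.+1 := widen_ord (leqnSn n) i.
have wE i : w i = lift ord_max i.
  by apply/val_inj; rewrite /= /bump leqNgt ltn_ord.
rewrite big_ord_recr /= /pushforward.
pose a' : 'rV[R]_n := \row_i a ord0 (w i).
pose b' : 'rV[R]_n := \row_i b ord0 (w i).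
rewrite [X in product_measure1 _ _ X](_ : _ =
    [set v : 'rV[R]_n | forall i, (v ord0 i \in `[a' ord0 i, b' ord0 i])%R] `*`
    [set` `[a ord0 ord_max, b ord0 ord_max]%R]); last first.
  apply/seteqP; split=> -[v x] /=.
    move=> vx; split=> [i|]; last first.
      by have := vx ord_max; rewrite mxE unlift_none.
    by have := vx (w i); rewrite !mxE wE liftK /= -wE.
  move=> [va xa] i; rewrite mxE; case: unliftP => [j ->|->] //=.
  by have := va j; rewrite !mxE wE.
rewrite product_measure1E //=; last first.
  rewrite (_ : [set v : 'rV[R]_n | _] = \bigcap_(i in [set: 'I_n])
      ((fun v : borel_rV R n => (v : 'rV[R]_n) ord0 i) @^-1`
         [set` `[a' ord0 i, b' ord0 i]%R])); last first.
    by apply/seteqP; split=> v /= vP i //=; exact: vP.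
  apply: fin_bigcap_measurable => // i _.
  rewrite -[X in measurable X]setTI.
  by apply: continuous_measurable_rV => //; exact: coord_continuous.
rewrite IH; last by move=> i; rewrite !mxE; exact: ab.
rewrite lebesgue_measure_itv /= lte_fin.
under eq_bigr do rewrite !mxE.
have [_|ba] := ltP (a ord0 ord_max) (b ord0 ord_max); first by rewrite EFinM.
have -> : b ord0 ord_max = a ord0 ord_max by apply/le_anti; rewrite ba ab.
by rewrite subrr mulr0 mule0.
Qed.

End lebesgue_rV_measure.

Section definitions.
Context (R : realType) (n : nat).
Implicit Types (x y v : 'rV[R]_n) (u : 'rV[R]_n -> R).
Implicit Types mu : set (borel_rV R n) -> \bar R.

Definition enorm v : R := Num.sqrt (\sum_i v ord0 i ^+ 2).

Definition eball x (r : R) : set 'rV[R]_n := [set y | enorm (y - x) < r].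

Definition locally_finite mu :=
  forall K : set 'rV[R]_n, compact K -> (mu K < +oo)%E.

Definition maximal_function (alpha : R) mu x : \bar R :=
  ereal_sup [set ((r `^ alpha)%:E * (mu (eball x r) /
                    lebesgue_rV R n (eball x r)))%E | r in [set r : R | 0 < r]].

Definition Lipc u :=
  (exists k : R, forall x y, `|u x - u y| <= k * enorm (x - y)) /\
  compact (closure [set x | u x != 0]).

(* A Lipschitz u is differentiable almost everywhere only. Where a partial
   derivative does not exist, 'D_ has an arbitrary value; these points form a
   Lebesgue null set. *)
Definition gradient u x : 'rV[R]_n := \row_i 'D_(delta_mx ord0 i) u x.

Definition lorentz_norm1 mu (q : R) u : \bar R :=
  (q%:E * \int[@lebesgue_measure R]_(t in `]0%R, +oo[)
            (mu [set x : 'rV[R]_n | (t < `|u x|)%R] `^ q^-1))%E.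

End definitions.

(* Main.v *)
Require Import Defs.
From HB Require Import structures.
From mathcomp Require Import all_boot all_order all_algebra.
From mathcomp Require Import all_classical all_reals all_analysis.
From mathcomp Require Import measurable_realfun.
From mathcomp Require Import ring lra.

(* For each level t > 0 the open set E = {|u| > t} is covered by disjoint dyadic
   cubes P with 2^-(n+1) |P| <= |E `&` P| <= |P| / 2. On such a cube of side s a
   discrete relative isoperimetric inequality on a fine grid of step h bounds
   s^(n-1) by the measure of the points x of P with exactly one of x, x + h e_j
   in E, divided by h and summed over j. Since q >= 1,
   mu E ^ (1/q) <= \sum_P mu P ^ (1/q), and
   mu P ^ (1/q) = (s^(1-n) mu P ^ (1/q)) s^(n-1), whose first factor is at most
   C (M_alpha mu)^(1/q) on all of P. Integrating in t turns the crossing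
   condition into | |u x| - |u (x + h e_j)| |, and h -> 0 gives the partial
   derivatives of u, which exist almost everywhere: in dimension one by
   Radon-Nikodym and Lebesgue differentiation, then by Fubini on lines. *)

Set Implicit Arguments.
Unset Strict Implicit.
Unset Printing Implicit Defensive.

Import Order.TTheory GRing.Theory Num.Theory.
Import numFieldNormedType.Exports.

Local Open Scope classical_set_scope.
Local Open Scope ring_scope.

(** * Almost everywhere differentiability of Lipschitz functions on the line *)

Section lipschitz_derivable.
Context (R : realType).
Local Notation leb := (@lebesgue_measure R).

(** What is attached to a level depends on [t] with no uniformity: the selected cubes, and the scale
    from which the grid inequality holds on them. Two devices remove this dependence. The weights
    s^(1-n) mu^(1/q) of the selected cubes are replaced by [maxweight N], the largest weight among
    those of the first [N] dyadic cubes that contain the point: it does not see [t], and it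
    dominates because selected cubes are disjoint. The thresholds on the scale are absorbed by lower
    limits, in the scale for fixed [N] and then in [N], so that Fatou's lemma applies to each. The
    truncation at [N] makes the threshold a maximum of finitely many numbers and the weight
    integrable, as dominated convergence needs when h -> 0. No perimeter appears: exchanging the
    integrals in t and x at a fixed step h is a discrete coarea formula. The value of alpha is
    forced by scaling: for a ball of radius r comparable to s, r^alpha mu / r^n is r^(-q(n-1)) mu,
    whose q-th root is the weight up to a constant. *)

Lemma lebesgue_stieltjes_le (g : cumulative R R) (k : R) : 0 < k ->
  (forall x y, x <= y -> g y - g x <= k * (y - x)) ->
  forall A, measurable A ->
    (lebesgue_stieltjes_measure g A <= k%:E * leb A)%E.
Proof.
move=> k0 gk A mA; rewrite /lebesgue_measure /lebesgue_stieltjes_measure.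
rewrite /measure_extension /mu_ext -ereal_inf_pZl//.
(* Both outer measures are infima over the same covers by half-open intervals, so one cover is
   compared term by term. *)
apply: le_ereal_inf_tmp => _ /= [_ [B mB <-] <-].
rewrite -nneseriesZl; last first.
- by move=> i _; exact: wlength_ge0.
apply: ge_ereal_inf; eexists; first by exists B; [exact: mB|reflexivity].
apply: lee_nneseries => [i _ _|i _]; first exact: wlength_ge0.
have [[a b] _ <-] /= := mB.1 i.
have [ab|ab] := leP a b; last by rewrite set_itv_ge ?wlength0 ?mule0// bnd_simp -leNgt ltW.
by rewrite !wlength_itv_bnd// -EFinM lee_fin gk.
Qed.

Lemma lebesgue_stieltjes_itv (g : cumulative R R) (a b : R) : a <= b ->
  lebesgue_stieltjes_measure g `]a, b] = (g b - g a)%:E.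
Proof.
move=> ab; rewrite /lebesgue_stieltjes_measure /measure_extension.
rewrite measurable_mu_extE/=; last exact: is_ocitv.
by rewrite wlength_itv_bnd.
Qed.

(** Adding [k * x] makes [f] nondecreasing, hence the distribution function of a Stieltjes measure.
    That measure is dominated by a multiple of [leb], so it has a density, and Lebesgue
    differentiation of the integral of the density gives the derivative. *)
Lemma lipschitz_ae_derivable (f : R -> R) (k : R) :
  (forall x y, `|f x - f y| <= k * `|x - y|) ->
  {ae leb, forall x, derivable f x 1}.
Proof.
move=> fk; have k0 : 0 <= k.
  by have := fk 1 0; rewrite subr0 normr1 mulr1; exact: le_trans.
pose g x := f x + k * x.
have fk' x y : x <= y -> `|f y - f x| <= k * (y - x).
  by move=> xy; rewrite -[X in k * X]ger0_norm ?fk// subr_ge0.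
have ndg : {homo g : x y / x <= y}.
  move=> x y xy; rewrite /g; have := fk' _ _ xy; rewrite ler_norml => /andP[+ _].
  by lra.
have cf : continuous f.
  move=> x; apply/(@cvgrPdist_le _ R^o) => /= e e0.
  near=> y; rewrite (le_trans (fk _ _))//.
  apply: (@le_trans _ _ ((k + 1) * `|x - y|)); first by rewrite ler_wpM2r// lerDl.
  rewrite -ler_pdivlMl ?ltr_wpDl//; near: y.
  by apply: (@cvgr_dist_le _ R^o) => //; rewrite mulr_gt0// invr_gt0 ltr_wpDl.
have cg : continuous g.
  by move=> x; apply: cvgD; [exact: cf|apply: cvgMr; exact: cvg_id].
pose gC : cumulative R R := HB.pack g
  (isCumulative.Build R _ R g ndg (right_continuousW cg)).
(* Restricting to []-m, m]] makes the Stieltjes measure finite; the countably many [m] are combined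
   at the end. *)
have main (m : nat) : {ae leb, forall x, - m%:R < x -> x < m%:R -> derivable f x 1}.
  have mm : - m%:R <= m%:R :> R by rewrite (le_trans _ (ler0n _ _))// oppr_le0.
  pose D : set (measurableTypeR R) := [set` `]- m%:R, m%:R]].
  have mD : measurable D by exact: measurable_itv.
  have Dfin : (lebesgue_stieltjes_measure gC D < +oo)%E.
    by rewrite lebesgue_stieltjes_itv// ltry.
  pose nu : {finite_measure set (measurableTypeR R) -> \bar R} := mfrestr mD Dfin.
  have nuleb : nu `<< leb.
    apply/null_content_dominatesP => A mA A0; apply/eqP.
    rewrite -measure_le0 /= /mfrestr /mrestr.
    apply: (@le_trans _ _ (lebesgue_stieltjes_measure gC A)).
      by apply: le_measure; rewrite ?inE//; exact: measurableI.
    (* The slope of [g] is at most [2 * k]; the extra 1 keeps the constant positive when [k = 0]. *)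
    apply: (@le_trans _ _ ((2 * k + 1)%:E * leb A)%E).
      apply: lebesgue_stieltjes_le => //; first by rewrite ltr_wpDl// mulr_ge0.
      move=> x y xy; rewrite /= /g; have := fk' _ _ xy.
      by rewrite ler_norml => /andP[_]; lra.
    by rewrite A0 mule0.
  have [h [h0 hfin hint nuE]] := radon_nikodym_sigma_finite nuleb.
  pose h' := fine \o h.
  have hE : h = EFin \o h' by apply/funext => x; rewrite /= fineK.
  have inth y : leb.-integrable [set` Interval (BRight (- m%:R)) (BRight y)] (EFin \o h').
    by rewrite -hE; exact: integrableS hint.
  have loch : locally_integrable [set: R] h'.
    by apply: open_integrable_locally; [exact: openT|rewrite -hE].
  have := FTC1 inth loch.
  apply: filterS; first exact: (ae_filter_ringOfSetsType leb).
  move=> x H mx xm; have [dF _] := H mx.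
  have -> : f = (fun z => g z - k * z) by apply/funext => z; rewrite /g addrK.
  have dg : derivable g x 1.
    set F := (F in derivable F _ _) in dF.
    (* On the interval [g] is the integral of the density up to the constant [g (- m%:R)], so
       derivability passes from [F] to [g]. *)
    have gE y : y \in `]- m%:R, m%:R[ -> F y + g (- m%:R) = g y.
      rewrite in_itv/= => /andP[my ym].
      suff : (\int[leb]_(t in [set` Interval (BRight (- m%:R)%R) (BRight y)]) h t)%E = (g y - g (- m%:R))%:E.
        by rewrite hE /F /Rintegral => -> /=; rewrite subrK.
      rewrite -nuE//= /mfrestr /mrestr setIidl.
        by apply: lebesgue_stieltjes_itv; exact: ltW.
      by move=> z; rewrite /D /= !in_itv/= => /andP[-> /le_trans->//]; exact: ltW.
    apply: (@near_eq_derivable _ _ _ (F + cst (g (- m%:R)))).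
    - near=> y; apply: gE; near: y; apply: near_in_itvoo.
      by rewrite in_itv/= mx xm.
    - by apply: derivableD => //; exact: derivable_cst.
  by apply: derivableB => //; apply: derivableM => //; exact: derivable_cst.
have : {ae leb, forall x (m : nat), - m%:R < x -> x < m%:R -> derivable f x 1}.
  exact/ae_foralln.
apply: filterS; first exact: (ae_filter_ringOfSetsType leb).
move=> x /(_ (Num.truncn `|x|).+1).
have : `|x| < (Num.truncn `|x|).+1%:R by rewrite truncnS_gt.
by rewrite ltr_norml => /andP[? ?]; exact.
Unshelve. all: by end_near.
Qed.

End lipschitz_derivable.

(** * Lebesgue measure on R^n: half-open boxes, translations, null sets by slices *)

Section lebesgue_rV_theory.
Context (R : realType).
Local Notation leb := (@lebesgue_measure R).

Lemma measurable_rV_coord n (i : 'I_n) :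
  measurable_fun setT (fun v : borel_rV R n => (v : 'rV[R]_n) ord0 i).
Proof. by apply: continuous_measurable_rV; exact: coord_continuous. Qed.

Lemma measurable_rV_box n (B : 'I_n -> set R) : (forall i, measurable (B i)) ->
  measurable ([set v | forall i, B i ((v : 'rV[R]_n) ord0 i)] : set (borel_rV R n)).
Proof.
move=> mB; rewrite (_ : [set v | _] = \bigcap_(i in [set: 'I_n])
    ((fun v : borel_rV R n => (v : 'rV[R]_n) ord0 i) @^-1` B i)); last first.
  by apply/seteqP; split=> v /= vP i //=; exact: vP.
apply: fin_bigcap_measurable => // i _.
by rewrite -[X in measurable X]setTI; exact: measurable_rV_coord.
Qed.

Let lebesgue_rV_sigma_finite n : sigma_finite setT (lebesgue_rV R n).
Proof.
exists (fun k : nat => [set v : 'rV[R]_n | forall i,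
    (v ord0 i \in `[(const_mx (- k%:R) : 'rV[R]_n) ord0 i,
      (const_mx k%:R : 'rV[R]_n) ord0 i])]).
  apply/seteqP; split=> // v _.
  exists (\max_(i < n) (Num.truncn `|v ord0 i|).+1) => // i; rewrite /= !mxE.
  rewrite in_itv/= -ler_norml (@le_trans _ _ (Num.truncn `|v ord0 i|).+1%:R)//.
    by rewrite ltW// truncnS_gt.
  by rewrite ler_nat; exact: leq_bigmax.
move=> k; split.
  by apply: (@measurable_rV_box n (fun i => [set` `[_, _]])) => i; exact: measurable_itv.
rewrite lebesgue_rV_box ?ltry// => i; rewrite !mxE.
by rewrite (le_trans _ (ler0n _ _))// oppr_le0.
Qed.

HB.instance Definition _ n := @Measure_isSigmaFinite.Build _ _ _
  (lebesgue_rV R n) (@lebesgue_rV_sigma_finite n).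

(** Half-open boxes are the shape of the cubes cut out by [Num.floor], which tile the space without
    overlap. *)
Lemma lebesgue_rV_cobox n (a b : 'rV[R]_n) :
  (forall i, (a ord0 i <= b ord0 i)%R) ->
  lebesgue_rV R n
    [set v : 'rV[R]_n | forall i, (v ord0 i \in `[a ord0 i, b ord0 i[)%R] =
  (\prod_(i < n) (b ord0 i - a ord0 i))%:E.
Proof.
elim: n a b => [a b _|n IH a b ab].
  by rewrite big_ord0 /= diracE mem_set//= => -[].
pose w i : 'I_n.+1 := widen_ord (leqnSn n) i.
have wE i : w i = lift ord_max i.
  by apply/val_inj; rewrite /= /bump leqNgt ltn_ord.
rewrite big_ord_recr /= /pushforward.
pose a' : 'rV[R]_n := \row_i a ord0 (w i).
pose b' : 'rV[R]_n := \row_i b ord0 (w i).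
rewrite [X in product_measure1 _ _ X](_ : _ =
    [set v : 'rV[R]_n | forall i, (v ord0 i \in `[a' ord0 i, b' ord0 i[)%R] `*`
    [set` `[a ord0 ord_max, b ord0 ord_max[%R]); last first.
  apply/seteqP; split=> -[v x] /=.
    move=> vx; split=> [i|]; last first.
      by have := vx ord_max; rewrite mxE unlift_none.
    by have := vx (w i); rewrite !mxE wE liftK /= -wE.
  move=> [va xa] i; rewrite mxE; case: unliftP => [j ->|->] //=.
  by have := va j; rewrite !mxE wE.
rewrite product_measure1E //=; last first.
  by apply: (@measurable_rV_box n (fun i => [set` `[_, _[])) => i; exact: measurable_itv.
rewrite IH; last by move=> i; rewrite !mxE; exact: ab.
rewrite lebesgue_measure_itv /= lte_fin.
under eq_bigr do rewrite !mxE.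
have [_|ba] := ltP (a ord0 ord_max) (b ord0 ord_max); first by rewrite EFinM.
have -> : b ord0 ord_max = a ord0 ord_max by apply/le_anti; rewrite ba ab.
by rewrite subrr mulr0 mule0.
Qed.

Lemma lebesgue_measure_shift (t : R) (B : set R) : measurable B ->
  leb ((fun x => x + t) @^-1` B) = leb B.
Proof.
move=> mB; apply/esym.
have mt : measurable_fun [set: measurableTypeR R] (fun x : measurableTypeR R => x + t : measurableTypeR R).
  by apply: measurable_funD => //; exact: measurable_id.
have [m mE] : exists m : {measure set (measurableTypeR R) -> \bar R},
    m = pushforward leb (fun x : measurableTypeR R => x + t : measurableTypeR R) :> (set _ -> \bar R).
  by unshelve (eexists (pushforward leb (fun x : measurableTypeR R => x + t : measurableTypeR R))).
transitivity (m B); last by rewrite mE.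
have := @lebesgue_measure_unique R m; apply => // _ [[a b] _ <-] /=.
rewrite mE /pushforward (_ : _ @^-1` _ = `]a - t, b - t]%classic).
  rewrite !lebesgue_measure_itv/= !lte_fin ltrD2r; case: ifPn => // _.
  by rewrite -!EFinB; congr (_%:E); lra.
by apply/seteqP; split=> z /=; rewrite !in_itv/= ltrBlDr lerBrDr.
Qed.

Lemma rcons_rVD n (x y : 'rV[R]_n) (s t : R) :
  rcons_rV (x + y, s + t) = (rcons_rV (x, s) + rcons_rV (y, t) : 'rV_n.+1).
Proof. by apply/rowP => i; rewrite !mxE; case: unliftP => //= j _; rewrite mxE. Qed.

Lemma rcons_rV_lastK n (v : 'rV[R]_n.+1) :
  rcons_rV (\row_i v ord0 (lift ord_max i) : 'rV_n, v ord0 ord_max) = v.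
Proof. by apply/rowP => i; rewrite !mxE; case: unliftP => [j ->|->]//=; rewrite mxE. Qed.

Lemma measurable_rV_shift n (v : 'rV[R]_n) :
  measurable_fun setT (fun x : borel_rV R n => ((x : 'rV[R]_n) + v : borel_rV R n)).
Proof.
apply: measurable_fun_rV => i; under eq_fun do rewrite mxE.
by apply: measurable_funD => //; exact: measurable_rV_coord.
Qed.

(** Induction on the dimension: the image of the product measure under a product of translations has
    the same values on rectangles, and [product_measure_unique] identifies it. *)
Lemma lebesgue_rV_shift n (v : 'rV[R]_n) (B : set (borel_rV R n)) : measurable B ->
  lebesgue_rV R n ((fun x : 'rV[R]_n => x + v) @^-1` B) = lebesgue_rV R n B.
Proof.
elim: n v B => [v B mB|n IH v B mB].
  by rewrite (_ : _ @^-1` B = B)//; apply/seteqP; split => x /=; rewrite [v]thinmx0 addr0.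
rewrite /= /pushforward.
pose v' : 'rV[R]_n := \row_i v ord0 (lift ord_max i).
pose t := v ord0 ord_max.
pose sg (p : borel_rV R n * measurableTypeR R) : borel_rV R n * measurableTypeR R := ((p.1 : 'rV[R]_n) + v', p.2 + t).
have msg : measurable_fun setT sg.
  apply/measurable_fun_pairP; split.
    apply: (@measurable_fun_rV _ (borel_rV R n * measurableTypeR R)%type) => i /=.
    under eq_fun do rewrite mxE; apply: measurable_funD => //.
    apply: (measurableT_comp (f := fun v : borel_rV R n => (v : 'rV[R]_n) ord0 i)).
      exact: measurable_rV_coord.
    exact: measurable_fst.
  by apply: measurable_funD => //; exact: measurable_snd.
set m := (lebesgue_rV R n \x leb)%E.
have mB' : measurable (@rcons_rV R n @^-1` B).
  by rewrite -[X in measurable X]setTI; exact: measurable_rcons_rV.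
rewrite (_ : _ @^-1` _ = sg @^-1` (@rcons_rV R n @^-1` B)); last first.
  by apply/seteqP; split=> -[x s] /=; rewrite /sg/= rcons_rVD rcons_rV_lastK.
have [m' m'E] : exists m' : {measure set (borel_rV R n * measurableTypeR R) -> \bar R}, m' = pushforward m sg :> (set _ -> \bar R).
  by unshelve (eexists (pushforward m sg)).
transitivity (m' (@rcons_rV R n @^-1` B)); first by rewrite m'E.
have := @product_measure_unique _ _ _ _ _ (lebesgue_rV R n) leb m'; move=> puq; apply/esym/puq => // C D mC mD; rewrite m'E.
rewrite /pushforward (_ : sg @^-1` _ = ((fun x : 'rV[R]_n => x + v') @^-1` C) `*` ((fun x => x + t) @^-1` D))//.
rewrite /m product_measure1E.
- congr (_ * _)%E; [exact: IH|exact: lebesgue_measure_shift].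
- by rewrite -[X in measurable X]setTI; exact: measurable_rV_shift.
- by rewrite -[X in measurable X]setTI; apply: measurable_funD => //; exact: measurable_id.
Qed.

(** By Fubini. If [i] is the last coordinate, the inner integral runs over the given slices;
    otherwise the order of integration is reversed, and the induction hypothesis applies for each
    fixed last coordinate. *)
Lemma lebesgue_rV_null_slices n (i : 'I_n) (Z : set (borel_rV R n)) : measurable Z ->
  (forall x : 'rV[R]_n, leb [set t | Z (x + t *: delta_mx ord0 i)] = 0%E) ->
  lebesgue_rV R n Z = 0%E.
Proof.
elim: n i Z => [[]//|n IH] i Z mZ Z0.
have mZ' : measurable (@rcons_rV R n @^-1` Z).
  by rewrite -[X in measurable X]setTI; exact: measurable_rcons_rV.
have deltaE (j : 'I_n) (x : 'rV[R]_n) (t s : R) :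
    rcons_rV (x + s *: delta_mx ord0 j : 'rV_n, t) =
    (rcons_rV (x, t) : 'rV_n.+1) + s *: delta_mx ord0 (lift ord_max j).
  apply/rowP => k; rewrite !mxE; case: unliftP => [l ->|->]/=.
    by rewrite !mxE (inj_eq lift_inj).
  by rewrite eq_liftF/= mulr0 addr0.
rewrite /= /pushforward.
case: (unliftP ord_max i) => [j|] iE; last first.
  rewrite /product_measure1; apply: integral0_eq => x _ /=.
  rewrite -[RHS](Z0 (rcons_rV (x, 0))); congr (leb _).
  have rE t : rcons_rV (x, t) = (rcons_rV (x, 0) : 'rV_n.+1) + t *: delta_mx ord0 i.
    apply/rowP => k; rewrite !mxE iE; case: unliftP => [l ->|->]/=.
      by rewrite eq_sym eq_liftF/= mulr0 addr0.
    by rewrite eqxx mulr1 add0r.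
  by apply/seteqP; split=> t; rewrite /xsection/= inE/= -rE.
transitivity ((lebesgue_rV R n \x^ leb)%E (@rcons_rV R n @^-1` Z)).
  have puq := @product_measure_unique _ _ _ _ _ (lebesgue_rV R n) leb (lebesgue_rV R n \x^ leb)%E.
  by apply: puq => // C D mC mD; exact: product_measure2E.
rewrite /product_measure2; apply: integral0_eq => t _ /=.
apply: (IH j); first exact: measurable_ysection.
move=> x; rewrite -[RHS](Z0 (rcons_rV (x, t))); congr (leb _).
by apply/seteqP; split=> s; rewrite /ysection/= inE/= deltaE iE.
Qed.

End lebesgue_rV_theory.

(** * Partial derivatives of Lipschitz functions exist almost everywhere *)

Section partial_derivative.
Context (R : realType) (n : nat).
Implicit Types (x y v : 'rV[R]_n) (u : 'rV[R]_n -> R).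
Local Notation leb := (@lebesgue_measure R).

Lemma enorm_le v (b : R) : 0 <= b -> (forall i, `|v ord0 i| <= b) ->
  enorm v <= n%:R * b.
Proof.
move=> b0 vb; rewrite /enorm -(@ger0_norm _ (n%:R * b)) ?mulr_ge0//.
rewrite -sqrtr_sqr ler_sqrt ?sqr_ge0// exprMn.
apply: (@le_trans _ _ (n%:R * b ^+ 2)).
  rewrite mulr_natl -[X in _ *+ X]card_ord -sumr_const ler_sum// => i _.
  by rewrite -real_normK ?num_real// lerXn2r ?nnegrE.
by rewrite ler_wpM2r ?sqr_ge0// -natrX ler_nat expnS expn1; case: (n) => // m; rewrite leq_pmulr.
Qed.

Lemma enorm_delta (t : R) (i : 'I_n) : enorm (t *: delta_mx ord0 i) = `|t|.
Proof.
rewrite /enorm (bigD1 i)//= big1 ?addr0 => [|j ji]; rewrite !mxE ?eqxx/=.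
  by rewrite mulr1 sqrtr_sqr.
by rewrite (negbTE ji) mulr0 expr0n.
Qed.

Definition elipschitz (k : R) u := forall x y, `|u x - u y| <= k * enorm (x - y).

Lemma elipschitz_ge0 k u (i : 'I_n) : elipschitz k u -> 0 <= k.
Proof.
move=> uk; have := uk (1 *: delta_mx ord0 i) 0.
by rewrite subr0 enorm_delta normr1 mulr1; exact: le_trans.
Qed.

Lemma elipschitz_continuous k u : 0 <= k -> elipschitz k u -> continuous u.
Proof.
move=> k0 uk x; apply/(@cvgrPdist_le _ R^o _ (nbhs x) (nbhs_filter x)) => /= e e0.
have c0 : 0 < k * n%:R + 1 by rewrite ltr_wpDl// mulr_ge0.
rewrite near_simpl; apply/nbhs_ballP; exists (e / (k * n%:R + 1)); first by rewrite /= divr_gt0.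
move=> y [_ xy]; apply: (le_trans (uk _ _)).
apply: (@le_trans _ _ (k * (n%:R * (e / (k * n%:R + 1))))).
  rewrite ler_wpM2l// enorm_le ?divr_ge0// ?ltW// => i; rewrite !mxE ltW//.
  exact: xy.
rewrite !mulrA ler_pdivrMr// mulrC ler_wpM2l//; first exact: ltW.
by rewrite lerDl.
Qed.

Let quot u (i : 'I_n) (h : R) x := h^-1 *: (u (h *: delta_mx ord0 i + x) - u x).

(* The Cauchy criterion for the difference quotients, with all real steps at once:
   an intersection of closed sets is closed however large it is. *)
Let Cauchy_set u i (m l : nat) : set 'rV[R]_n :=
  \bigcap_(p in [set p : R * R | [/\ p.1 != 0, p.2 != 0,
     `|p.1| < l.+1%:R^-1 & `|p.2| < l.+1%:R^-1]])
  [set x | `|quot u i p.1 x - quot u i p.2 x| <= m.+1%:R^-1].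

Let bad u i : set 'rV[R]_n := ~` (\bigcap_m \bigcup_l Cauchy_set u i m l).

Let quot_continuous u i h : continuous u -> continuous (quot u i h).
Proof.
move=> cu x.
have sh : h *: delta_mx ord0 i + y @[y --> x] --> h *: delta_mx ord0 i + x.
  exact: (cvgD (cvg_cst _) cvg_id).
have ush : u (h *: delta_mx ord0 i + y) @[y --> x] --> u (h *: delta_mx ord0 i + x).
  exact: (cvg_comp _ _ sh (cu _)).
exact: (cvgM (cvg_cst _) (cvgB ush (cu x))).
Qed.

Let measurable_bad u i : continuous u -> measurable (bad u i : set (borel_rV R n)).
Proof.
move=> cu; apply: measurableC; apply: bigcapT_measurable => m.
apply: bigcupT_measurable => l.
have cE : closed (Cauchy_set u i m l).
  apply: closed_bigI => p _.
  rewrite (_ : [set x | _] = (fun x => `|quot u i p.1 x - quot u i p.2 x|) @^-1` [set t | t <= m.+1%:R^-1])//.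
  apply: preimage_closed; last exact: closed_le.
  move=> x _; exact: (cvg_norm (cvgB (@quot_continuous u i p.1 cu x) (@quot_continuous u i p.2 cu x))).
rewrite -[X in measurable X]setCK; apply: measurableC.
by apply: sub_sigma_algebra; rewrite /= openC.
Qed.

(** Derivability in a direction is convergence of the difference quotients as the step tends to 0,
    which completeness of R turns into their Cauchy property. The exceptional set is thus Borel, as
    the slice criterion for null sets requires. *)
Let not_bad_derivable u i x : ~ bad u i x <-> derivable u x (delta_mx ord0 i).
Proof.
have -> : derivable u x (delta_mx ord0 i) = cvg (quot u i h x @[h --> 0^']) by [].
apply: iff_trans (cauchy_cvgP _); apply: iff_trans (cauchy_ballP _).
rewrite /bad /setC /= notK; split=> [qx e e0|qx m _].
  have [m me] : exists m : nat, m.+1%:R^-1 < e.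
    exists (Num.truncn e^-1); rewrite invf_plt ?posrE//; exact: truncnS_gt.
  have [l _ ql] := qx m Logic.I.
  have near0 : \forall h \near (0 : R)^', `|h| < l.+1%:R^-1.
    apply: dnbhs0_lt; by rewrite invr_gt0 ltr0n.
  pose B := [set z | exists h, [/\ h != 0, `|h| < l.+1%:R^-1 & z = quot u i h x]].
  have FB : (quot u i h x @[h --> 0^']) B.
    have neq0 : \forall h \near (0 : R)^', h != 0 by exact: nbhs_dnbhs_neq.
    suff : \forall h \near (0 : R)^', B (quot u i h x) by [].
    by apply: filterS2 neq0 near0 => h h0 hl; exists h; split.
  exists (B, B) => // -[_ _] [/= [h [h0 hl ->]] [h' [h'0 h'l ->]]].
  by apply: le_lt_trans me; exact: (ql (h, h')).
have [[A B] [/= FA FB] AB] := qx m.+1%:R^-1 ltac:(by rewrite invr_gt0 ltr0n).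
have /nbhs_ballP[d /= d0 dAB] : nbhs (0 : R) (fun h => h != 0 -> A (quot u i h x) /\ B (quot u i h x)).
  have FA' : \forall h \near (0 : R)^', A (quot u i h x) := FA.
  have FB' : \forall h \near (0 : R)^', B (quot u i h x) := FB.
  have : \forall h \near (0 : R)^', A (quot u i h x) /\ B (quot u i h x).
    by apply: filterS2 FA' FB'.
  by [].
have [l ld] : exists l : nat, l.+1%:R^-1 < d.
  exists (Num.truncn d^-1); rewrite invf_plt ?posrE//; exact: truncnS_gt.
have dE (h : R) : `|h| < l.+1%:R^-1 -> ball (0 : R) d h.
  by move=> hl; rewrite -ball_normE /ball_/= sub0r normrN; exact: lt_trans ld.
exists l => // -[h h'] [/= h0 h'0 hl h'l]; apply: ltW.
apply: (AB (quot u i h x, quot u i h' x)); split => /=.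
  by have [] := dAB h (dE _ hl) h0.
by have [] := dAB h' (dE _ h'l) h'0.
Unshelve. all: by end_near.
Qed.

(** On a line of direction [i] the function is Lipschitz in the parameter with the same [k], the
    direction having Euclidean length 1; so each slice of [bad] is null by the one-dimensional
    result. *)
Lemma partial_derivable_ae k u i : elipschitz k u ->
  {ae lebesgue_rV R n, forall x, derivable u x (delta_mx ord0 i)}.
Proof.
move=> uk; have k0 := elipschitz_ge0 i uk.
have cu := elipschitz_continuous k0 uk.
exists (bad u i); split; first exact: measurable_bad.
  apply: (@lebesgue_rV_null_slices R n i); first exact: measurable_bad.
  move=> x; pose f t := u (x + t *: delta_mx ord0 i).
  have fk s t : `|f s - f t| <= k * `|s - t|.
    rewrite (le_trans (uk _ _))// opprD addrACA subrr add0r -scalerBl.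
    by rewrite enorm_delta.
  have [N [mN N0 fN]] := lipschitz_ae_derivable fk.
  have mbx : measurable_fun setT (fun t : measurableTypeR R => x + t *: delta_mx ord0 i : borel_rV R n).
    apply: measurable_fun_rV => j; under eq_fun do rewrite !mxE.
    apply: measurable_funD; first exact: measurable_cst.
    by apply: measurable_funM; [exact: measurable_id|exact: measurable_cst].
  apply/eqP; rewrite -measure_le0 -N0 le_measure ?inE//.
    by rewrite -[X in measurable X]setTI; apply: mbx => //; exact: measurable_bad.
  apply: subset_trans fN => t /= bad_t df; apply: (not_bad_derivable u i _).2 bad_t.
  rewrite /derivable (_ : (fun h => _) = (fun h => h^-1 *: ((f \o shift t) (h *: 1) - f t)))//.
  apply/funext => h /=; rewrite /f [h *: 1]mulr1 scalerDl.
  by congr (_ *: (u _ - _)); rewrite addrCA.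
move=> x /= nd; apply: contrapT => nb; apply: nd.
exact/not_bad_derivable.
Qed.

End partial_derivative.

(** * A discrete relative isoperimetric inequality on a grid of M^n points *)

Section grid_isoperimetry.
Context (n M : nat).
Local Open Scope nat_scope.
Local Notation grid := {ffun 'I_n -> 'I_M}.
Implicit Types (a b j : grid) (i : 'I_n) (f : grid -> bool).

Definition upd j i (c : 'I_M) : grid := [ffun l => if l == i then c else j l].

(** The neighbour [c] must itself lie in ['I_M], so no edge leaves the grid: this is what makes the
    inequality relative to the cube. *)
Definition grid_edge f i j :=
  [exists c : 'I_M, (c == (j i).+1 :> nat) && (f j != f (upd j i c))].

Let upd_id j i : upd j i (j i) = j.
Proof. by apply/ffunP => l; rewrite ffunE; case: eqP => // ->. Qed.

(** If [f] jumped across no edge of the line, it would keep its value from index 0 along the whole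
    line. *)
Let line_edge f i j c : f j != f (upd j i c) -> exists p, grid_edge f i (upd j i p).
Proof.
apply: contraPP => noedge; apply/negP; rewrite negbK.
have step (p q : 'I_M) : q = p.+1 :> nat -> f (upd j i p) = f (upd j i q).
  move=> qp; apply/eqP; apply/negPn/negP => fpq; apply: noedge; exists p.
  apply/existsP; exists q; rewrite ffunE eqxx qp eqxx/=.
  by rewrite (_ : upd (upd j i p) i q = upd j i q)//; apply/ffunP => l; rewrite !ffunE; case: eqP.
have all0 (p q : 'I_M) : p = 0 :> nat -> f (upd j i p) = f (upd j i q).
  move=> p0; case: q => k; elim: k => [|k IH] kM.
    by congr (f (upd j i _)); exact: val_inj.
  by rewrite (IH (ltnW kM)); exact: step.
have M0 : 0 < M by case: (M) c => [[]|].
by rewrite -{1}(upd_id j i) -(all0 (Ordinal M0)) ?(all0 (Ordinal M0) c).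
Qed.

(** Canonical path from [a], at [m = 0], to [b], at [m = n], moving along one direction per step. *)
Let hyb (m : nat) a b : grid := [ffun l : 'I_n => if l < m then b l else a l].

Let bool_telescope (g : nat -> bool) k :
  (g 0 != g k) <= \sum_(m < k) (g m != g m.+1).
Proof.
elim: k => [|k IH]; first by rewrite eqxx big_ord0.
rewrite big_ord_recr/=; apply: leq_trans (leq_add IH (leqnn _)).
by case: (g 0) (g k) (g k.+1) => [] [] [].
Qed.

(* Swapping the first i coordinates of the pair turns a hybrid step into a move
   of one point along a line of direction i. *)
Let hyb_edge f i :
  \sum_(p : grid * grid) (f (hyb i p.1 p.2) != f (hyb i.+1 p.1 p.2)) <=
  M ^ n.+1 * \sum_j grid_edge f i j.
Proof.
have Inv : involutive (fun p : grid * grid => (hyb i p.1 p.2, hyb i p.2 p.1)).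
  by move=> [a b]; congr pair; apply/ffunP => l /=; rewrite !ffunE; case: ltnP.
rewrite (reindex_inj (inv_inj Inv))/=.
(* Exchanging the free value [c] with the [i]-th coordinate permutes the pairs, so each grid point
   is hit [M] times in [lineE]. *)
have Inv2 : involutive (fun p : grid * 'I_M => (upd p.1 i p.2, p.1 i)).
  move=> [a c]; congr pair => /=; last by rewrite ffunE eqxx.
  by apply/ffunP => l; rewrite !ffunE; case: eqP => // ->.
have lineE : \sum_(p : grid * 'I_M) grid_edge f i (upd p.1 i p.2) = M * \sum_j grid_edge f i j.
  rewrite (reindex_inj (inv_inj Inv2))/=.
  under eq_bigr => p _.
    rewrite (_ : upd _ i _ = p.1); last first.
      by apply/ffunP => l; rewrite !ffunE; case: eqP => // ->.
  over.
  rewrite -(pair_big xpredT xpredT (fun a (c : 'I_M) => grid_edge f i a : nat))/=.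
  by under eq_bigr do rewrite sum_nat_const card_ord; rewrite big_distrr.
(* The factor is [M] from [lineE] times the M^n choices of [b], on which the summand does not
   depend. *)
have -> : M ^ n.+1 * \sum_j grid_edge f i j =
    \sum_(b : grid) \sum_(p : grid * 'I_M) grid_edge f i (upd p.1 i p.2).
  by rewrite lineE sum_nat_const card_ffun !card_ord mulnA -expnSr.
rewrite -(pair_big xpredT xpredT (fun a b => (f (hyb i (hyb i a b) (hyb i b a)) !=
  f (hyb i.+1 (hyb i a b) (hyb i b a))) : nat))/= exchange_big/=.
apply: leq_sum => b _.
rewrite -(pair_big xpredT xpredT (fun a c => grid_edge f i (upd a i c) : nat))/=.
apply: leq_sum => a _.
have -> : hyb i (hyb i a b) (hyb i b a) = a.
  by apply/ffunP => l; rewrite !ffunE; case: ltnP.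
have -> : hyb i.+1 (hyb i a b) (hyb i b a) = upd a i (b i).
  apply/ffunP => l; rewrite !ffunE ltnS -val_eqE/=.
  by case: ltngtP => // /val_inj ->.
(* A jump is charged to one edge on the line through [a] in direction [i], whose starting point is
   among the values being summed. *)
case: eqP => //= /eqP /line_edge[p ep].
by rewrite (bigD1 p)//= ep leq_addr.
Qed.

(** The left side counts pairs [(a, b)] with [f a] true and [f b] false. Along the canonical path
    from [a] to [b] the value must jump at some step, and [hyb_edge] bounds the number of jumps at
    each step. *)
Lemma grid_isoperimetry f :
  (\sum_j f j) * (\sum_j ~~ f j) <= M ^ n.+1 * \sum_i \sum_j grid_edge f i j.
Proof.
rewrite big_distrlr/= pair_big/=.
apply: (@leq_trans (\sum_(p : grid * grid) \sum_(i < n) (f (hyb i p.1 p.2) != f (hyb i.+1 p.1 p.2)))).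
  apply: leq_sum => -[a b] _ /=.
  apply: leq_trans (bool_telescope (fun m => f (hyb m a b)) n).
  have -> : hyb 0 a b = a by apply/ffunP => l; rewrite ffunE.
  have -> : hyb n a b = b by apply/ffunP => l; rewrite ffunE ltn_ord.
  by case: (f a) (f b) => [] [].
rewrite exchange_big big_distrr/=; apply: leq_sum => i _; exact: hyb_edge.
Qed.

End grid_isoperimetry.

Lemma measure_bigcup_finType d (T : measurableType d) (R : realType)
    (mu : {measure set T -> \bar R}) (I : finType) (F : I -> set T) :
  (forall i, measurable (F i)) -> trivIset setT F ->
  mu (\bigcup_i F i) = (\sum_i mu (F i))%E.
Proof.
move=> mF tF; rewrite measure_fin_bigcup//.
  have -> : [set: I] = [set` index_enum I].
    by apply/seteqP; split=> i _ //=; exact: mem_index_enum.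
  by rewrite -fsbig_seq// index_enum_uniq.
exact: finite_finset.
Qed.

Lemma integral_sum_indic d (T : measurableType d) (R : realType)
    (mu : {measure set T -> \bar R}) (I : finType) (D : set T) (X : I -> set T) (c : R) :
  0 <= c -> measurable D -> (forall i, measurable (X i)) ->
  (\int[mu]_(x in D) (c * \sum_i \1_(X i) x)%:E = c%:E * \sum_i mu (D `&` X i))%E.
Proof.
move=> c0 mD mX; under eq_integral do rewrite EFinM -sumEFin.
rewrite ge0_integralZl_EFin//.
- congr (_ * _)%E; rewrite ge0_integral_sum// => [|i].
    by apply: eq_bigr => i _; rewrite integral_indic// setIC.
  by apply/measurable_EFinP; exact: measurable_indic.
- by move=> x _; apply: sume_ge0 => i _; rewrite lee_fin.
- apply: emeasurable_sum => i; apply/measurable_EFinP; exact: measurable_indic.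
Qed.

(** * Grid cubes and the isoperimetric inequality on one of them *)

Section cubes.
Context (R : realType) (n : nat).
Implicit Types (x y v : 'rV[R]_n) (s h : R) (m : {ffun 'I_n -> int}).
Implicit Types (E B : set (borel_rV R n)).
Local Notation L := (lebesgue_rV R n).

(** Membership is an equation between floors, so the cubes of one side partition the space and
    [cube_of] reads off the index. *)
Definition cube s m : set (borel_rV R n) :=
  [set y : 'rV[R]_n | forall i, Num.floor (y ord0 i / s) = m i].

Definition cube_of s x : {ffun 'I_n -> int} := [ffun i => Num.floor (x ord0 i / s)].

Lemma mem_cube_of s x : cube s (cube_of s x) x.
Proof. by move=> i; rewrite ffunE. Qed.

Lemma cube_ofE s m x : cube s m x <-> m = cube_of s x.
Proof.
split=> [xm|->]; last exact: mem_cube_of.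
by apply/ffunP => i; rewrite ffunE -xm.
Qed.

Lemma cubeE s m : 0 < s -> cube s m =
  [set y | forall i, y ord0 i \in `[(m i)%:~R * s, (m i + 1)%:~R * s[].
Proof.
move=> s0; apply/seteqP; split=> y /= ym i.
  by rewrite in_itv/= -ler_pdivlMr// -ltr_pdivrMr// -ym floor_itv.
apply: floor_def; have := ym i.
by rewrite in_itv/= -ler_pdivlMr// -ltr_pdivrMr.
Qed.

Lemma measurable_cube s m : 0 < s -> measurable (cube s m : set (borel_rV R n)).
Proof.
move=> s0; rewrite cubeE//.
by apply: (@measurable_rV_box R n (fun i => [set` `[_, _[])) => i; exact: measurable_itv.
Qed.

Lemma lebesgue_cube s m : 0 < s -> L (cube s m) = (s ^+ n)%:E.
Proof.
move=> s0; rewrite cubeE//.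
have := @lebesgue_rV_cobox R n (\row_i ((m i)%:~R * s)) (\row_i ((m i + 1)%:~R * s)).
have -> : [set v : 'rV[R]_n | forall i, (v ord0 i \in `[(\row_j ((m j)%:~R * s)) ord0 i,
    (\row_j ((m j + 1)%:~R * s)) ord0 i[)%R] =
    [set y | forall i, y ord0 i \in `[(m i)%:~R * s, (m i + 1)%:~R * s[].
  by apply/seteqP; split=> y /= ym i; have := ym i; rewrite !mxE.
move=> ->; last first.
  by move=> i; rewrite !mxE; apply: ler_wpM2r; [exact: ltW|rewrite ler_int lerDl].
congr (_%:E); rewrite (eq_bigr (fun=> s)) ?prodr_const ?card_ord// => i _.
by rewrite !mxE -mulrBl intrD addrAC subrr add0r mul1r.
Qed.

Lemma cube_ofD h x (j : 'I_n -> int) : 0 < h ->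
  cube_of h (x + \row_i (h * (j i)%:~R)) = [ffun i => cube_of h x i + j i].
Proof.
move=> h0; apply/ffunP => i; rewrite !ffunE !mxE mulrDl mulrAC divff ?gt_eqF// mul1r.
by rewrite floorDrz ?intr_int// intrKfloor.
Qed.

Lemma cube_of_coarse h (M : nat) x : 0 < h -> (0 < M)%N ->
  forall i, (cube_of (M%:R * h) x i * M <= cube_of h x i < (cube_of (M%:R * h) x i + 1) * M)%R.
Proof.
move=> h0 M0 i; rewrite !ffunE.
have M0' : 0 < (M%:R : R) by rewrite ltr0n.
have E : x ord0 i / h = x ord0 i / (M%:R * h) * M%:R.
  by rewrite invfM mulrA mulrAC mulfVK// gt_eqF.
have /andP[lo hi] := floor_itv (x ord0 i / (M%:R * h)).
apply/andP; split.
  by rewrite floor_ge_int E intrM ler_wpM2r ?ler0n.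
by rewrite floor_lt_int E intrM ltr_pM2r.
Qed.

Section fine.
Context (h : R) (h0 : 0 < h) (M : nat) (M0 : (0 < M)%N) (m : {ffun 'I_n -> int}).
Local Notation grid := {ffun 'I_n -> 'I_M}.
Implicit Types (j : grid).
Local Notation P := (cube (M%:R * h) m).

Definition grid_vec j : 'rV[R]_n := \row_i (h * (j i : int)%:~R).

Definition fine_index j : {ffun 'I_n -> int} := [ffun i => m i * M%:Z + (j i : int)].

(** The fine cube at the lower corner of [P]. The others are its translates, so a point [x] of it
    stands for the grid of points [x + grid_vec j] in [P]. *)
Definition base_cube := cube h [ffun i => m i * M%:Z].

Lemma base_cubeD x j : base_cube x <-> cube h (fine_index j) (x + grid_vec j).
Proof.
rewrite /base_cube !cube_ofE cube_ofD//; split=> [<-|/ffunP E].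
  by apply/ffunP => i; rewrite !ffunE.
by apply/ffunP => i; have := E i; rewrite !ffunE => /addIr.
Qed.

Lemma cube_fineP x : P x <-> exists j, cube h (fine_index j) x.
Proof.
split=> [/cube_ofE mE|[j /cube_ofE jE]]; last first.
  apply/cube_ofE/ffunP => i; have /ffunP/(_ i) := jE; rewrite !ffunE => {}jE.
  have := cube_of_coarse x h0 M0 i; rewrite !ffunE -jE.
  have := ltn_ord (j i); move: (Num.floor _) (m i) (j i : nat) => c mi k kM /andP[lo hi].
  have k0 : 0 <= k%:Z by [].
apply/eqP; rewrite eq_le; apply/andP; split; rewrite leNgt; apply/negP => cm.
    have : (c + 1) * M%:Z <= mi * M%:Z by rewrite ler_wpM2r// lezD1.
    rewrite leNgt; case/negP; apply: le_lt_trans hi; by rewrite lerDl.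
  have : (mi + 1) * M%:Z <= c * M%:Z by rewrite ler_wpM2r// lezD1.
  rewrite leNgt; case/negP; apply: le_lt_trans lo _; by rewrite mulrDl mul1r ltrD2l ltz_nat.
have lt i : (absz (cube_of h x i - m i * M%:Z)%R < M)%N.
  have := cube_of_coarse x h0 M0 i; rewrite -mE => /andP[lo hi].
  by rewrite -ltz_nat gez0_abs ?subr_ge0// ltrBlDl (lt_le_trans hi)// mulrDl mul1r.
exists [ffun i => Ordinal (lt i)]; apply/cube_ofE/ffunP => i; rewrite !ffunE/=.
have := cube_of_coarse x h0 M0 i; rewrite -mE !ffunE => /andP[lo hi].
by rewrite gez0_abs ?subr_ge0// addrC subrK.
Qed.

Lemma fine_index_inj : injective fine_index.
Proof.
move=> j k /ffunP jk; apply/ffunP => i; have := jk i; rewrite !ffunE.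
by move=> /addrI[]; exact: val_inj.
Qed.

(** Translating each fine cube back to [base_cube] makes a measure in [P] the integral over
    [base_cube] of a number of grid points; the counting inequality enters this way. *)
Lemma lebesgue_cube_fine B : measurable B ->
  L (P `&` B) = (\sum_j L (base_cube `&` (fun x : 'rV[R]_n => (x + grid_vec j)%R) @^-1` B))%E.
Proof.
move=> mB; have -> : P `&` B = \bigcup_(j in [set: grid]) (cube h (fine_index j) `&` B).
  rewrite -setI_bigcupl; congr (_ `&` _); apply/seteqP; split=> x.
    by move=> /cube_fineP[j xj]; exists j.
  by move=> [j _ xj]; apply/cube_fineP; exists j.
have mQ j : measurable (cube h (fine_index j) `&` B : set (borel_rV R n)).
  by apply: measurableI => //; exact: measurable_cube.
rewrite measure_bigcup_finType//.
- apply: eq_bigr => j _.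
  apply: etrans (esym (lebesgue_rV_shift (grid_vec j) (mQ j))) _; congr (L _).
  by apply/seteqP; split=> x [/base_cubeD].
- move=> j k _ _ [x [[/cube_ofE jE _] [/cube_ofE kE _]]].
  by apply: fine_index_inj; rewrite jE kE.
Qed.

(** A product of two measures is a product of integrals over [base_cube], not the integral of a
    product. With [inner E] in place of [E] the first count no longer depends on the base point, and
    the two can be multiplied under one integral. *)
Definition inner E : set (borel_rV R n) :=
  \bigcup_(m' in [set m' | cube h m' `<=` E]) cube h m'.

Lemma measurable_inner E : measurable (inner E).
Proof.
rewrite /inner bigcup_mkcond; apply: countable_bigcupT_measurable => // m'.
by case: ifPn => // _; exact: measurable_cube.
Qed.

Definition step_diff (t : R) (i : 'I_n) E : set (borel_rV R n) :=
  [set x | (x \in E) != (((x : 'rV[R]_n) + t *: delta_mx ord0 i) \in E)].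

Lemma measurable_step_diff t i E : measurable E -> measurable (step_diff t i E).
Proof.
move=> mE; set E' : set (borel_rV R n) := (fun x : 'rV[R]_n => x + t *: delta_mx ord0 i) @^-1` E.
have mE' : measurable E' by rewrite -[X in measurable X]setTI; exact: measurable_rV_shift.
rewrite (_ : step_diff t i E = (E `\` E') `|` (E' `\` E)).
  by apply: measurableU; exact: measurableD.
apply/seteqP; split=> x; rewrite /step_diff /E' /=.
  by case: (boolP (x \in E)) => [/set_mem xE|/negP xE];
     case: (boolP (_ \in E)) => [/set_mem yE|/negP yE] //= _; [left|right];
     split=> // ?; [apply: yE|apply: xE]; exact: mem_set.
by case=> -[/mem_set -> yE]; [rewrite memNset|rewrite (memNset yE)].
Qed.

(** For each [x] of [base_cube] apply [grid_isoperimetry] to the trace of [E] on the points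
    [x + grid_vec j], then integrate in [x]. *)
Lemma cube_isoperimetry E : measurable E ->
  (L (P `&` inner E) * L (P `&` ~` E) <=
   ((M%:R * h) ^+ n * M%:R)%:E * \sum_i L (P `&` step_diff h i E))%E.
Proof.
move=> mE.
pose A j : bool := `[< cube h (fine_index j) `<=` E >].
pose S x j : bool := (x + grid_vec j) \in E.
have AS x j : base_cube x -> A j -> S x j.
  by move=> xQ /asboolP jE; apply/mem_set/jE/base_cubeD.
have mS j B : measurable B -> measurable ((fun x : 'rV[R]_n => x + grid_vec j) @^-1` B : set (borel_rV R n)).
  by move=> mB; rewrite -[X in measurable X]setTI; exact: measurable_rV_shift.
have mQ0 : measurable (base_cube : set (borel_rV R n)) by exact: measurable_cube.
have inE : L (P `&` inner E) = ((h ^+ n)%:E * (\sum_j A j)%N%:R%:E)%E.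
  rewrite lebesgue_cube_fine; last exact: measurable_inner.
  rewrite natr_sum -sumEFin ge0_sume_distrr//.
  apply: eq_bigr => j _; rewrite -EFinM.
  have [/asboolP jE|/asboolPn jE] := boolP (A j).
    rewrite mulr1 -(@lebesgue_cube h [ffun i => m i * M%:Z])//; congr (L _).
    apply/seteqP; split=> [x []//|x xQ]; split => //=.
    by exists (fine_index j) => //; exact/base_cubeD.
  rewrite mulr0; rewrite (_ : _ `&` _ = set0) ?measure0//.
  rewrite -subset0 => x [/base_cubeD/cube_ofE xQ [m' /= m'E /cube_ofE xm']].
  by apply: jE; rewrite xQ -xm'.
pose D i j x : bool := `[< step_diff h i E (x + grid_vec j) >].
have count x : base_cube x ->
  ((\sum_j A j) * (\sum_j ~~ S x j) <= M ^ n.+1 * \sum_i \sum_j (D i j x))%N.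
  move=> xQ; apply: (@leq_trans ((\sum_j S x j) * (\sum_j ~~ S x j))).
    rewrite leq_mul2r; apply/orP; right; apply: leq_sum => j _.
    by case: (A j) (AS x j xQ) => // /(_ erefl) ->.
  apply: leq_trans (grid_isoperimetry (S x)) _; rewrite leq_mul2l; apply/orP; right.
  apply: leq_sum => i _; apply: leq_sum => j _.
  (* Going to the next grid point in direction [i] is a translation by [h], so the start of a
     jumping edge lies in [step_diff h i E]. *)
  rewrite /grid_edge; case: existsP => // -[c /andP[/eqP cj Sj]].
  rewrite /D asboolT// /step_diff /= (_ : _ + _ + _ = x + grid_vec (upd j i c))//.
  rewrite -addrA; congr (_ + _); apply/rowP => l; rewrite !mxE ffunE eqxx/=; case: (l =P i) => [->|_]/=.
    by rewrite cj -[X in _ + X * _](mulr1 h) mulr1 -mulrDr natr1.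
  by rewrite mulr0 addr0.
set a := (\sum_j A j)%N in inE count.
have mSc j : measurable ((fun x : 'rV[R]_n => x + grid_vec j) @^-1` (~` E) : set (borel_rV R n)).
  by apply: mS; exact: measurableC.
have mD (p : 'I_n * grid) : measurable ((fun x : 'rV[R]_n => x + grid_vec p.2) @^-1` step_diff h p.1 E : set (borel_rV R n)).
  by apply: mS; exact: measurable_step_diff.
rewrite inE (lebesgue_cube_fine (measurableC mE)) -muleA.
rewrite -(@integral_sum_indic _ _ _ _ _ base_cube)//.
apply: (@le_trans _ _ ((h ^+ n)%:E * \int[L]_(x in base_cube)
   ((M ^ n.+1)%:R * \sum_(p : 'I_n * grid) \1_((fun x : 'rV[R]_n => x + grid_vec p.2) @^-1` step_diff h p.1 E) x)%:E)%E).
  apply: lee_wpmul2l; first by rewrite lee_fin exprn_ge0// ltW.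
  apply: ge0_le_integral => //.
  - by move=> x _; rewrite lee_fin mulr_ge0// sumr_ge0.
  - by apply/measurable_EFinP; apply: measurable_funM => //; apply: measurable_sum => j; exact: measurable_indic.
  - by apply/measurable_EFinP; apply: measurable_funM => //; apply: measurable_sum => j; exact: measurable_indic.
  - move=> x xQ; rewrite lee_fin; have := count x xQ.
    rewrite -(ler_nat R) !natrM !natr_sum; congr (_ * _ <= _ * _).
      apply: eq_bigr => j _; rewrite indicE; congr (_%:R); congr nat_of_bool.
      by apply/idP/idP => [/negP xE|/set_mem xE]; [apply/mem_set => /mem_set|apply/negP => /set_mem].
    rewrite -(pair_big xpredT xpredT (fun i j => \1_((fun x : 'rV[R]_n => x + grid_vec j) @^-1` step_diff h i E) x : R))/=.
    apply: eq_bigr => i _; rewrite natr_sum; apply: eq_bigr => j _.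
    by rewrite indicE; congr (_%:R); congr nat_of_bool; apply/asboolP/idP => [xD|/set_mem//]; exact: mem_set.
rewrite integral_sum_indic// muleA -EFinM.
rewrite -(pair_big xpredT xpredT (fun i j => L (base_cube `&`
  ((fun x : 'rV[R]_n => x + grid_vec j) @^-1` step_diff h i E))))/=.
(* The volume of a fine cube times [M ^ n.+1] from the count is the volume of [P] times [M]. *)
have -> : h ^+ n * (M ^ n.+1)%:R = (M%:R * h) ^+ n * M%:R.
  by rewrite natrX exprSr exprMn mulrA [h ^+ n * _]mulrC.
by under [in leRHS]eq_bigr => i _ do rewrite (lebesgue_cube_fine (measurable_step_diff h i mE)).
Qed.

End fine.
End cubes.

(** * Dyadic scales, and the isoperimetric inequality for all fine enough steps *)

Section dyadic.
Context (R : realType) (n : nat).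
Implicit Types (x y v : 'rV[R]_n) (s h : R) (m : {ffun 'I_n -> int}).
Implicit Types (E B : set (borel_rV R n)).
Local Notation L := (lebesgue_rV R n).

Lemma cube_of_mulr h (M : nat) x y : 0 < h -> (0 < M)%N ->
  cube_of h x = cube_of h y -> cube_of (M%:R * h) x = cube_of (M%:R * h) y.
Proof.
move=> h0 M0 xy; apply/ffunP => i.
have := cube_of_coarse x h0 M0 i; have := cube_of_coarse y h0 M0 i; rewrite xy.
move: (cube_of _ _ i) (cube_of _ _ i) (cube_of _ _ i) => a b c.
move=> /andP[al ah] /andP[cl ch].
have M0' : 0 < M%:Z by rewrite ltz_nat.
have := le_lt_trans al ch; have := le_lt_trans cl ah.
rewrite !ltr_pM2r// !ltzD1 => ? ?; apply/eqP; rewrite eq_le; exact/andP.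
Qed.

Lemma cube_dist h m x y i : 0 < h -> cube h m x -> cube h m y ->
  `|x ord0 i - y ord0 i| < h.
Proof.
move=> h0; rewrite cubeE// => /(_ i) + /(_ i); rewrite !in_itv/= intrD mulrDl mul1r.
by rewrite ltr_distl => /andP[? ?] /andP[? ?]; apply/andP; split; lra.
Qed.

Variables (S : R) (S0 : 0 < S).
Definition side (k : nat) := S / 2 ^+ k.

Lemma side_gt0 k : 0 < side k.
Proof. by rewrite divr_gt0// exprn_gt0. Qed.

Lemma sideD a k : side a = (2 ^ k)%:R * side (a + k).
Proof.
rewrite /side exprD natrX invfM [RHS]mulrC -!mulrA mulVf ?mulr1//.
Qed.

Lemma side_lt e : 0 < e -> exists k, side k < e.
Proof.
move=> e0; exists (Num.truncn (S / e)).+1.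
rewrite /side ltr_pdivrMr ?exprn_gt0// mulrC -ltr_pdivrMr//.
apply: lt_le_trans (truncnS_gt _) _; rewrite -natrX ler_nat.
exact/ltnW/ltn_expl.
Qed.

Lemma cube_of_side a b x y : (a <= b)%N -> cube_of (side b) x = cube_of (side b) y ->
  cube_of (side a) x = cube_of (side a) y.
Proof.
move=> /subnKC <-; rewrite (sideD a (b - a)); apply: cube_of_mulr; first exact: side_gt0.
by rewrite expn_gt0.
Qed.

Lemma inner_side_nd E : nondecreasing_seq (fun k => inner (side k) E).
Proof.
apply/nondecreasing_seqP => k; apply/subsetPset => x [m /= mE /cube_ofE xm].
exists (cube_of (side k.+1) x); last exact: mem_cube_of.
move=> y /= /cube_ofE /esym yx; apply: mE; apply/cube_ofE; rewrite xm.
by apply: esym; apply: cube_of_side yx.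
Qed.

(** Around each point of an open set a small enough cube fits, so replacing [E] by [inner] loses
    nothing in the limit. *)
Lemma bigcup_inner_side E : open (E : set 'rV[R]_n) -> \bigcup_k inner (side k) E = E.
Proof.
move=> oE; apply/seteqP; split=> [x [k _ [m /= mE xm]]|x Ex]; first exact: mE.
have : nbhs (x : 'rV[R]_n) (E : set 'rV[R]_n) by rewrite nbhsE /=; exists E.
rewrite -nbhs_ballE => -[e /= e0 xeE]; have [k ke] := side_lt e0.
exists k => //; exists (cube_of (side k) x); last exact: mem_cube_of.
move=> y /= yx; apply: xeE; split=> // i j; rewrite (ord1 i) /ball/=.
apply: lt_trans ke; exact: (cube_dist j (side_gt0 k) (mem_cube_of _ _) yx).
Qed.

Lemma open_measurable_rV (E : set 'rV[R]_n) : open E -> measurable (E : set (borel_rV R n)).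
Proof. by move=> oE; apply: sub_sigma_algebra; exact: oE. Qed.

(** Continuity of the measure along increasing sets: if the inequality failed for arbitrarily large
    [k], monotonicity would make it fail for every [k], hence in the limit. *)
Lemma inner_side_large m s E (c : R) : 0 < s -> open (E : set 'rV[R]_n) ->
  (c%:E < L (cube s m `&` E))%E ->
  exists k0, forall k, (k0 <= k)%N -> (c%:E < L (cube s m `&` inner (side k) E))%E.
Proof.
move=> s0 oE cE; apply: contrapT => /forallNP nk.
suff : (L (cube s m `&` E) <= c%:E)%E by rewrite leNgt cE.
have mP := measurable_cube m s0.
have mF k : measurable (cube s m `&` inner (side k) E).
  by apply: measurableI => //; exact: (measurable_inner (side_gt0 k)).
have ndF : nondecreasing_seq (fun k => cube s m `&` inner (side k) E).
  move=> k l kl; apply/subsetPset; apply: setIS; apply/subsetPset; exact: inner_side_nd.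
rewrite -(bigcup_inner_side oE) setI_bigcupr.
have mU : measurable (\bigcup_k (cube s m `&` inner (side k) E)) by exact: bigcupT_measurable.
have cvgF : L (cube s m `&` inner (side k) E) @[k --> \oo] --> L (\bigcup_k (cube s m `&` inner (side k) E)).
  exact: nondecreasing_cvg_mu.
apply: (cvge_to_le cvgF).
apply: nearW => k; rewrite leNgt; apply/negP => ck; apply: (nk k) => l kl.
apply: lt_le_trans ck _; rewrite le_measure ?inE//; exact/subsetPset/ndF.
Qed.

(** Both factors on the left of [cube_isoperimetry] are fixed fractions of the volume s^n; dividing
    by s^n M, where M is s / [side k], leaves s^(n-1). The exponent [n.+3] is [n.+2] for the inner
    part plus 1 for the complement. *)
Lemma isoperimetry a m E : (0 < n)%N -> open (E : set 'rV[R]_n) ->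
  ((side a ^+ n / 2 ^+ n.+1)%:E <= L (cube (side a) m `&` E))%E ->
  (L (cube (side a) m `&` E) <= (side a ^+ n / 2)%:E)%E ->
  exists k0, forall k, (k0 <= k)%N ->
    ((side a ^+ n.-1 / 2 ^+ n.+3)%:E <=
     (side k)^-1%:E * \sum_i L (cube (side a) m `&` step_diff (side k) i E))%E.
Proof.
move=> n0 oE loE upE; set s := side a in loE upE *; set P := cube s m in loE upE *.
have s0 : 0 < s by exact: side_gt0.
have sn0 : 0 < s ^+ n by rewrite exprn_gt0.
have mE : measurable E by exact: open_measurable_rV.
have mP : measurable P by exact: measurable_cube.
(* Half of the lower bound is given up, because [inner_side_large] starts from a strict
   inequality. *)
have [k0 k0P] : exists k0, forall k, (k0 <= k)%N ->
    ((s ^+ n / 2 ^+ n.+2)%:E < L (P `&` inner (side k) E))%E.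
  apply: inner_side_large => //; apply: lt_le_trans loE.
  by rewrite lte_fin ltr_pM2l// ltf_pV2 ?posrE ?exprn_gt0// ltr_eXn2l// ltr1n.
(* With [a <= k] the side of the cube is exactly [2 ^ (k - a)] steps. *)
exists (maxn k0 a) => k; rewrite geq_max => /andP[/k0P kin ak].
have outE : ((s ^+ n / 2)%:E <= L (P `&` ~` E))%E.
  have : L P = (L (P `&` E) + L (P `&` ~` E))%E.
    by rewrite (measureDI L mP mE) addeC setDE.
  rewrite lebesgue_cube//.
  move: upE; case: (L (P `&` E)) => [r||]; case: (L (P `&` ~` E)) => [t||] //=; rewrite ?lee_fin ?leey//.
  by move=> rs [st]; lra.
have := @cube_isoperimetry R n (side k) (side_gt0 k) (2 ^ (k - a)) _ m E mE.
rewrite expn_gt0/= => /(_ erefl).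
have sE : (2 ^ (k - a))%:R * side k = s by rewrite /s (sideD a (k - a)) subnKC.
rewrite sE -/P => iso.
have {}iso : ((s ^+ n / 2 ^+ n.+2 * (s ^+ n / 2))%:E <= (s ^+ n * (2 ^ (k - a))%:R)%:E * (\sum_i L (P `&` step_diff (side k) i E)))%E.
  apply: le_trans iso; rewrite EFinM; apply: lee_pmul => //.
  - by rewrite lee_fin divr_ge0// ltW// exprn_gt0.
  - by rewrite lee_fin divr_ge0// ltW.
  - exact: ltW.
have Mk : (2 ^ (k - a))%:R = s / side k.
  by rewrite -sE mulfK// gt_eqF// side_gt0.
have : (0 <= \sum_i L (P `&` step_diff (side k) i E))%E by exact: sume_ge0.
move: iso; rewrite Mk; case: (\sum_i _)%E => [r||] //.
  rewrite -!EFinM !lee_fin => iso r0.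
  have h0 := side_gt0 k.
  have sE' : s ^+ n = s ^+ n.-1 * s by rewrite -exprSr prednK.
  rewrite -(ler_pM2l (_ : 0 < s ^+ n * s)) ?mulr_gt0//.
  apply: le_trans (le_trans iso _).
    rewrite [X in _ * X]mulrC -mulrA le_eqVlt; apply/orP; left; apply/eqP.
    rewrite [2 ^+ n.+3]exprSr invfM sE'; ring.
  by rewrite le_eqVlt; apply/orP; left; apply/eqP; ring.
by move=> _; rewrite gt0_muley ?leey// lte_fin invr_gt0 side_gt0.
Qed.

End dyadic.

(** * Power sums and countable subadditivity of mu^(1/q) *)

Section power_sums.
Context (R : realType).

(** Write x^q as x times x^(q-1), and use that the power q - 1 >= 0 is nondecreasing. *)
Lemma powR_superadditive (x y q : R) : 0 <= x -> 0 <= y -> 1 <= q ->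
  x `^ q + y `^ q <= (x + y) `^ q.
Proof.
move=> x0 y0 q1; have q0 : 0 < q by exact: lt_le_trans ltr01 q1.
rewrite -!(mulr_powRB1 _ q0)//; last exact: addr_ge0.
have q10 : 0 <= q - 1 by rewrite subr_ge0.
have mono (a b : R) : 0 <= a -> a <= b -> a `^ (q - 1) <= b `^ (q - 1).
  by move=> a0 ab; rewrite ge0_ler_powR// nnegrE (le_trans a0).
by rewrite mulrDl lerD// ler_wpM2l// mono// (lerDl, lerDr).
Qed.

Local Open Scope ereal_scope.

Lemma poweR_superadditive (x y : \bar R) (q : R) : 0 <= x -> 0 <= y -> (1 <= q)%R ->
  x `^ q + y `^ q <= (x + y) `^ q.
Proof.
move=> x0 y0 q1; have q0 : (q != 0)%R by rewrite gt_eqF// (lt_le_trans ltr01).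
case: x x0 => [x||]// x0; last first.
  by rewrite addye ?poweRyr ?leey// gt_eqF// (lt_le_trans _ y0)// ltNyr.
case: y y0 => [y||]// y0; last by rewrite addey ?poweRyr ?leey.
by rewrite lee_fin; exact: powR_superadditive.
Qed.

Lemma poweRVK (x : \bar R) (q : R) : (q != 0)%R -> 0 <= x -> (x `^ q^-1) `^ q = x.
Proof. by move=> q0 x0; rewrite -poweRrM mulVf// poweRe1. Qed.

Lemma poweRKV (x : \bar R) (q : R) : (q != 0)%R -> 0 <= x -> (x `^ q) `^ q^-1 = x.
Proof. by move=> q0 x0; rewrite -poweRrM mulfV// poweRe1. Qed.

Lemma sum_poweRV (a : nat -> \bar R) (F : pred nat) (q : R) N :
  (forall i, 0 <= a i) -> (1 <= q)%R ->
  \sum_(0 <= i < N | F i) a i <= (\sum_(0 <= i < N | F i) a i `^ q^-1) `^ q.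
Proof.
move=> a0 q1; have q0 : (q != 0)%R by rewrite gt_eqF// (lt_le_trans ltr01).
elim: N => [|N IH]; first by rewrite big_geq// poweR_ge0.
rewrite big_mkcond/= big_nat_recr//= -big_mkcond/=.
rewrite [in leRHS]big_mkcond/= big_nat_recr//= -big_mkcond/=.
apply: (@le_trans _ _ ((\sum_(0 <= i < N | F i) a i `^ q^-1) `^ q +
    (if F N then a N `^ q^-1 else 0) `^ q)).
  by apply: leeD => //; case: ifP => _; rewrite ?poweRVK ?poweR_ge0.
apply: poweR_superadditive => //; first by apply: sume_ge0 => i _; exact: poweR_ge0.
by case: ifP => _ //; exact: poweR_ge0.
Qed.

Lemma poweRV_measure_le d (T : measurableType d) (mu : {measure set T -> \bar R})
    (E : set T) (Q : nat -> set T) (F : pred nat) (q : R) :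
  (1 <= q)%R -> measurable E -> (forall i, measurable (Q i)) ->
  E `<=` \bigcup_(i in [set i | F i]) Q i ->
  mu E `^ q^-1 <= \sum_(0 <= i <oo | F i) mu (Q i) `^ q^-1.
Proof.
move=> q1 mE mQ EQ; have q0 : (q != 0)%R by rewrite gt_eqF// (lt_le_trans ltr01).
set S := (X in _ <= X).
have S0 : 0 <= S by apply: nneseries_ge0 => i _ _; exact: poweR_ge0.
suff : mu E <= S `^ q.
  move=> /(gt0_ler_poweR (r := q^-1)); rewrite poweRKV//; apply.
  - by rewrite invr_ge0 (le_trans ler01).
  - by rewrite in_itv/= measure_ge0 leey.
  - by rewrite in_itv/= poweR_ge0 leey.
apply: (@le_trans _ _ (\sum_(0 <= i <oo | F i) mu (Q i))).
  rewrite eseries_mkcond.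
  have mQF i : measurable (if F i then Q i else set0) by case: ifP.
  have sub : mu E <= \sum_(0 <= i <oo) mu (if F i then Q i else set0).
    have := measure_sigma_subadditive mu mQF mE; apply.
    by move=> x /EQ[i /= Fi Qx]; exists i => //; rewrite Fi.
  apply: le_trans sub _; apply: lee_nneseries => // i _; by case: ifP => //; rewrite measure0.
apply: lime_le; first exact: is_cvg_nneseries.
apply: nearW => N; apply: le_trans (sum_poweRV _ _ _ q1) _ => //.
apply: gt0_ler_poweR; rewrite ?in_itv/= ?leey ?S0 ?andbT//.
- by rewrite (le_trans ler01).
- by apply: sume_ge0 => i _; exact: poweR_ge0.
by apply: nneseries_lim_ge => i _ _; exact: poweR_ge0.
Qed.

End power_sums.

(** * Stopping-time selection of dyadic cubes, and their weights *)

Section covering.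
Context (R : realType) (n : nat) (n0 : (0 < n)%N) (S : R) (S0 : 0 < S).
Implicit Types (x y : 'rV[R]_n) (E : set (borel_rV R n)) (m : {ffun 'I_n -> int}).
Local Notation L := (lebesgue_rV R n).
Local Notation side := (side S).

(** The lower fraction is one half times 2^-n: a cube holds at least that much as soon as one of its
    dyadic children is more than half full. *)
Definition good E a m :=
  ((side a ^+ n / 2 ^+ n.+1)%:E <= L (cube (side a) m `&` E))%E /\
  (L (cube (side a) m `&` E) <= (side a ^+ n / 2)%:E)%E.

Definition maxgood E a m := good E a m /\
  forall x b, cube (side a) m x -> (b < a)%N -> ~ good E b (cube_of (side b) x).

(* Dyadic cubes are numbered by their countable set of codes (level, position);
   numbers that code nothing stand for the empty set. *)
Definition dcube (i : nat) : set (borel_rV R n) :=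
  if pickle_inv i is Some (a, m) then cube (side a) m else set0.

Definition selected E (i : nat) : bool :=
  if pickle_inv i is Some (a, m) then `[< maxgood E a m >] else false.

Lemma measurable_dcube i : measurable (dcube i).
Proof.
by rewrite /dcube; case: pickle_inv => [[a m]|] //; apply: measurable_cube; exact: side_gt0.
Qed.

(** Dyadic cubes sharing [x] are nested; were their levels different, the finer one would have a
    good cube above it, against maximality. *)
Lemma selected_disjoint E i j x :
  selected E i -> selected E j -> dcube i x -> dcube j x -> i = j.
Proof.
rewrite /selected /dcube.
have := @pickle_invK (nat * {ffun 'I_n -> int})%type i.
have := @pickle_invK (nat * {ffun 'I_n -> int})%type j.
case: (pickle_inv j) => [[b l]|]//= <-; case: (pickle_inv i) => [[a m]|]//= <-.
move=> /asboolP[ga ma] /asboolP[gb mb] xa xb; have := xa; have := xb.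
move=> /cube_ofE lE /cube_ofE mE.
case: (ltngtP a b) => ab.
- by case: (mb x a xb ab); rewrite -mE.
- by case: (ma x b xa ab); rewrite -lE.
- by rewrite mE lE ab.
Qed.

(** Small cubes around [x] lie inside [E], while the one of level 0 is at most half full. The parent
    of the first cube that is more than half full is good. *)
Lemma exists_good E x : open (E : set 'rV[R]_n) ->
  (forall m, (L (cube (side 0) m `&` E) <= (side 0 ^+ n / 2)%:E)%E) ->
  E x -> exists a, good E a (cube_of (side a) x).
Proof.
move=> oE top Ex.
have mE : measurable E by exact: open_measurable_rV.
have mC a : measurable (cube (side a) (cube_of (side a) x)) by apply: measurable_cube; exact: side_gt0.
pose p b := ~~ (L (cube (side b) (cube_of (side b) x) `&` E) <= (side b ^+ n / 2)%:E)%E.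
have [b pb] : exists b, p b.
  have : (\bigcup_k inner (side k) E) x by rewrite bigcup_inner_side.
  move=> [k _ [m /= mE' /cube_ofE xm]]; exists k; rewrite /p -ltNge.
  rewrite -xm setIidl// lebesgue_cube ?side_gt0// lte_fin.
  by rewrite ltr_pdivrMr// ltr_pMr ?ltr1n// exprn_gt0// side_gt0.
have [[|a] pa amin] := ex_minnP (ex_intro _ b pb).
  by move: pa; rewrite /p top.
exists a; split; last first.
  by have : ~~ p a by [apply/negP => /amin; rewrite ltnn]; rewrite /p negbK.
apply: (@le_trans _ _ (L (cube (side a.+1) (cube_of (side a.+1) x) `&` E))).
  apply: ltW; move: pa; rewrite /p -ltNge; congr (_ < _)%E; congr (_%:E).
  have -> : side a = 2 * side a.+1 by rewrite (sideD S a 1) addn1.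
  by rewrite [in RHS]exprMn [2 ^+ n.+1]exprSr -mulf_div divff ?mul1r// expf_neq0.
rewrite le_measure ?inE//; try exact: measurableI.
apply: setSI => y /= /cube_ofE yE; apply/cube_ofE.
exact: (cube_of_side S0 (leqnSn a) yE).
Qed.

Lemma selected_cover E : open (E : set 'rV[R]_n) ->
  (forall m, (L (cube (side 0) m `&` E) <= (side 0 ^+ n / 2)%:E)%E) ->
  E `<=` \bigcup_(i in [set i | selected E i]) dcube i.
Proof.
move=> oE top x Ex; have [a0 ga0] := exists_good oE top Ex.
(* The least good level at [x] gives a cube with no good cube above it. *)
have [a /asboolP ga amin] := ex_minnP (ex_intro (fun a => `[< good E a (cube_of (side a) x) >]) a0 (asboolT ga0)).
exists (pickle (a, cube_of (side a) x)); rewrite /= /selected /dcube pickleK_inv; last exact: mem_cube_of.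
apply/asboolP; split=> // y b /cube_ofE yx ba gb.
have : (a <= b)%N.
  apply: amin; apply/asboolP; rewrite (_ : cube_of (side b) x = cube_of (side b) y)//.
  by rewrite (cube_of_side S0 (ltnW ba) yx).
by rewrite leqNgt ba.
Qed.

Variables (mu : {measure set (borel_rV R n) -> \bar R}) (q : R).
Hypothesis mu_fin : forall i, (mu (dcube i) < +oo)%E.

Definition weight (i : nat) : R :=
  if pickle_inv i is Some (a, m)
  then fine (mu (cube (side a) m)) `^ q^-1 / side a ^+ n.-1 else 0.

Lemma weight_ge0 i : 0 <= weight i.
Proof.
rewrite /weight; case: pickle_inv => [[a m]|]//.
by rewrite divr_ge0 ?powR_ge0// exprn_ge0// ltW// side_gt0.
Qed.

(** Unlike the selection, this does not depend on [E], so one weight serves all levels. A maximum is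
    enough because selected cubes are disjoint, and taking finitely many cubes keeps it
    integrable. *)
Definition maxweight (N : nat) (x : borel_rV R n) : R :=
  \big[Num.max/0]_(i < N) (weight i * \1_(dcube i) x).

Lemma maxweight_ge0 N x : 0 <= maxweight N x.
Proof. by rewrite /maxweight; elim/big_rec: _ => // i y _ y0; rewrite le_max y0 orbT. Qed.

Lemma measurable_maxweight N : measurable_fun setT (maxweight N).
Proof.
rewrite /maxweight; elim: (index_enum _) => [|i s IH].
  by under eq_fun do rewrite big_nil; exact: measurable_cst.
under eq_fun do rewrite big_cons; apply: measurable_maxr => //.
by apply: measurable_funM => //; apply: measurable_indic; exact: measurable_dcube.
Qed.

Lemma sum_weight_le N E x :
  \sum_(0 <= i < N | selected E i) weight i * \1_(dcube i) x <= maxweight N x.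
Proof.
have [[i [iN si xi]]|none] := pselect (exists i, [/\ (i < N)%N, selected E i & dcube i x]).
  rewrite big_mkcond/= (bigD1_seq i) ?mem_index_iota ?iota_uniq//= si big1 ?addr0; last first.
    move=> j ji; case: ifP => // sj; rewrite indicE memNset ?mulr0// => xj.
    by move/eqP: ji; apply; exact: (selected_disjoint sj si xj xi).
  exact: (le_bigmax _ (fun i : 'I_N => weight i * \1_(dcube i) x) (Ordinal iN)).
rewrite big_nat_cond big1 ?maxweight_ge0// => i /andP[/andP[_ iN] si].
by rewrite indicE memNset ?mulr0// => xi; apply: none; exists i.
Qed.

Lemma sum_weight_integral_le N E (D : set (borel_rV R n)) : measurable D ->
  (\sum_(0 <= i < N | selected E i) (weight i)%:E * L (dcube i `&` D) <=
   \int[L]_x (maxweight N x * \1_D x)%:E)%E.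
Proof.
move=> mD.
have mI i : measurable_fun setT (fun x : borel_rV R n => (weight i * (\1_(dcube i) x * \1_D x))%:E : \bar R).
  apply/measurable_EFinP; apply: measurable_funM => //; apply: measurable_funM => //;
  apply: measurable_indic => //; exact: measurable_dcube.
have wE i : ((weight i)%:E * L (dcube i `&` D))%E = (\int[L]_x (weight i * (\1_(dcube i) x * \1_D x))%:E)%E.
  rewrite -[in LHS](setIT (dcube i `&` D)) -integral_indic//; last exact: measurableI (measurable_dcube i) mD.
  rewrite -ge0_integralZl_EFin ?weight_ge0//.
    by apply: eq_integral => x _; rewrite indicI EFinM.
  by apply/measurable_EFinP; apply: measurable_indic; apply: measurableI => //; exact: measurable_dcube.
under eq_bigr do rewrite wE.
have nonneg i x : 0 <= weight i * (\1_(dcube i) x * \1_D x) by rewrite !mulr_ge0// weight_ge0.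
rewrite -big_filter -ge0_integral_sum//; last by move=> i x _; rewrite lee_fin.
apply: ge0_le_integral => //.
- by move=> x _; apply: sume_ge0 => i _; rewrite lee_fin.
- exact: emeasurable_sum.
- apply/measurable_EFinP; apply: measurable_funM; first exact: measurable_maxweight.
  exact: measurable_indic.
move=> x _; rewrite sumEFin lee_fin big_filter.
under eq_bigr do rewrite mulrA; rewrite -mulr_suml ler_wpM2r//.
exact: sum_weight_le.
Qed.

(** On a selected cube of side s, mu^(1/q) is [weight] times s^(n-1), and [isoperimetry] bounds the
    latter. The threshold [k0] is the largest of those of the first [N] cubes, whence the
    truncation. *)
Lemma selected_bound E N : (1 <= q) -> open (E : set 'rV[R]_n) ->
  exists k0, forall k, (k0 <= k)%N ->
  (\sum_(0 <= i < N | selected E i) mu (dcube i) `^ q^-1 <=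
   (2 ^+ n.+3)%:E * ((side k)^-1%:E * \sum_(j < n)
     \int[L]_x (maxweight N x * \1_(step_diff (side k) j E) x)%:E))%E.
Proof.
move=> q1 oE; have q0 : q^-1 != 0 by rewrite invr_eq0 gt_eqF// (lt_le_trans ltr01).
have mE : measurable E by exact: open_measurable_rV.
have mD k j : measurable (step_diff (side k) j E) by exact: measurable_step_diff.
have /choice[K KP] : forall i, exists K : nat, forall k, (K <= k)%N -> selected E i ->
    (mu (dcube i) `^ q^-1 <= (2 ^+ n.+3)%:E * ((side k)^-1%:E * \sum_(j < n)
       ((weight i)%:E * L (dcube i `&` step_diff (side k) j E))))%E.
  move=> i; rewrite /selected /dcube /weight; case iE: (pickle_inv i) => [[a m]|]; last by exists 0%N.
  have [/asboolP[[lo up] _]|nsel] := boolP `[< maxgood E a m >]; last by exists 0%N.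
  have [k0 k0P] := isoperimetry S0 n0 oE lo up.
  exists k0 => k kk _; have := k0P k kk.
  have mufin : mu (cube (side a) m) \is a fin_num.
    by rewrite ge0_fin_numE//; have := mu_fin i; rewrite /dcube iE.
  set f := fine _ `^ _.
  have sa0 : 0 < side a ^+ n.-1 by rewrite exprn_gt0// side_gt0.
  move=> /(lee_wpmul2l (x := (2 ^+ n.+3 * (f / side a ^+ n.-1))%:E)) iso.
  rewrite -(fineK mufin) poweR_EFin -/f.
  apply: le_trans (le_trans _ (iso _)) _.
  - rewrite -EFinM lee_fin le_eqVlt; apply/orP; left; apply/eqP.
    have p0 : (2 : R) ^+ n.+3 != 0 by rewrite expf_neq0.
    move: sa0 p0; set c := _ ^+ n.-1; set p := 2 ^+ n.+3 => sa0 p0.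
    by field; rewrite p0 gt_eqF.
  - by rewrite lee_fin mulr_ge0 ?exprn_ge0// divr_ge0 ?powR_ge0// ltW.
  - rewrite EFinM -!muleA; apply: lee_wpmul2l; first by rewrite lee_fin exprn_ge0.
    by rewrite muleCA -ge0_sume_distrr.
exists (\max_(i < N) K i) => k kK.
have h0 : 0 <= (side k)^-1 by rewrite invr_ge0 ltW// side_gt0.
apply: (@le_trans _ _ (\sum_(0 <= i < N | selected E i) ((2 ^+ n.+3)%:E * ((side k)^-1%:E * \sum_(j < n)
       ((weight i)%:E * L (dcube i `&` step_diff (side k) j E)))))%E).
  rewrite big_nat_cond [leRHS]big_nat_cond; apply: lee_sum => i /andP[/andP[_ iN] si].
  apply: KP si; apply: leq_trans kK; exact: (leq_bigmax (Ordinal iN)).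
have w0 i j : (0 <= (weight i)%:E * L (dcube i `&` step_diff (side k) j E))%E.
  by rewrite mule_ge0// lee_fin weight_ge0.
rewrite -ge0_sume_distrr; last first.
  by move=> i _; rewrite mule_ge0 ?lee_fin// sume_ge0.
apply: lee_wpmul2l; first by rewrite lee_fin exprn_ge0.
rewrite -ge0_sume_distrr; last by move=> i _; rewrite sume_ge0.
apply: lee_wpmul2l; first by rewrite lee_fin.
rewrite exchange_big/=; apply: lee_sum => j _.
exact: sum_weight_integral_le.
Qed.

End covering.

(* The library's ge0_le_integral asks for the measurability of g, which is not
   available for the maximal function. *)
Lemma ge0_le_integralT d (T : measurableType d) (R : realType)
    (mu : {measure set T -> \bar R}) (f g : T -> \bar R) :
  (forall x, 0 <= f x)%E -> (forall x, f x <= g x)%E ->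
  (\int[mu]_x f x <= \int[mu]_x g x)%E.
Proof.
move=> f0 fg; rewrite !ge0_integralTE// => [|x]; last exact: le_trans (f0 x) (fg x).
apply: ereal_sup_le => _ [h /= hf <-]; exists h => //= x.
exact: le_trans (hf x) (fg x).
Qed.

(** * Lower integrals, lower limits and powers of quotients *)

Section lower_integral_scaling.
Import HBNNSimple.

(** For an arbitrary nonnegative [g] the integral is a supremum over simple functions below it; one
    that lies below [c * g] is divided by [c] to lie below [g]. *)
Lemma ge0_integralZl_leT d (T : measurableType d) (R : realType)
    (mu : {measure set T -> \bar R}) (c : R) (g : T -> \bar R) :
  0 < c -> (forall x, 0 <= g x)%E ->
  (\int[mu]_x (c%:E * g x) <= c%:E * \int[mu]_x g x)%E.
Proof.
move=> c0 g0; rewrite !ge0_integralTE// => [|x]; last by rewrite mule_ge0// lee_fin ltW.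
apply: ge_ereal_sup => _ [h /= hg <-].
have c'0 : 0 <= c^-1 by rewrite invr_ge0 ltW.
pose h' := scale_nnsfun h c'0.
have -> : sintegral mu h = (c%:E * sintegral mu h')%E.
  rewrite -sintegralrM; apply: eq_sintegral => x /=.
  by rewrite mulrA mulfV ?mul1r// gt_eqF.
apply: lee_wpmul2l; first by rewrite lee_fin ltW.
apply: ereal_sup_ubound; exists h' => //= x.
by rewrite EFinM -[leRHS]mul1e -(mulVf (lt0r_neq0 c0)) EFinM -muleA lee_wpmul2l// lee_fin.
Qed.

End lower_integral_scaling.

Section limn_einf_bounds.
Context (R : realType).
Implicit Types (u : (\bar R)^nat) (l : \bar R).

Lemma limn_einf_le u l : (forall k, u k <= l)%E -> (limn_einf u <= l)%E.
Proof.
move=> ul; rewrite limn_einf_lim; apply: lime_le; first exact: is_cvg_einfs.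
apply: nearW => k; apply: le_trans (ul k).
by apply: ereal_inf_lbound; exists k => /=.
Qed.

Lemma limn_einf_ge u l : (exists k0, forall k, (k0 <= k)%N -> (l <= u k)%E) ->
  (l <= limn_einf u)%E.
Proof.
move=> [k0 lu]; rewrite limn_einf_lim; apply: lime_ge; first exact: is_cvg_einfs.
exists k0 => // k /= kk; apply: le_ereal_inf_tmp => _ [j /= kj <-].
by apply: lu; exact: leq_trans kj.
Qed.

End limn_einf_bounds.

Lemma powR_divr (R : realType) (a b q : R) : 0 <= a -> 0 < b ->
  (a / b) `^ q = a `^ q / b `^ q.
Proof.
move=> a0 b0; have ab0 : 0 <= a / b by rewrite divr_ge0// ltW.
have -> : a `^ q = (a / b) `^ q * b `^ q by rewrite -powRM ?(ltW b0)// divfK// gt_eqF.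
by rewrite mulfK// gt_eqF// powR_gt0.
Qed.

(** * Euclidean balls, and the comparison of weights with the maximal function *)

Section euclidean_balls.
Context (R : realType) (n : nat).
Implicit Types (x y v : 'rV[R]_n).
Local Notation L := (lebesgue_rV R n).

Lemma ler_coord_enorm v i : `|v ord0 i| <= enorm v.
Proof.
rewrite /enorm -sqrtr_sqr ler_wsqrtr// (bigD1 i)//= lerDl sumr_ge0// => j _.
exact: sqr_ge0.
Qed.

Lemma measurable_eball x r : 0 < r -> measurable (eball x r : set (borel_rV R n)).
Proof.
move=> r0; pose f (y : borel_rV R n) : R := \sum_i ((y : 'rV[R]_n) ord0 i - x ord0 i) ^+ 2.
have sqE (y : 'rV[R]_n) : (enorm (y - x) < r) = (f y < r ^+ 2).
  rewrite -[in LHS](gtr0_norm r0) -sqrtr_sqr /enorm ltr_sqrt ?exprn_gt0//.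
  by congr (_ < _); apply: eq_bigr => i _; rewrite !mxE.
rewrite (_ : eball x r = f @^-1` `]-oo, r ^+ 2[%classic); last first.
  by apply/seteqP; split=> y; rewrite /eball/= in_itv/= sqE.
rewrite -[X in measurable X]setTI; apply: (_ : measurable_fun setT f) => //.
apply: measurable_sum => i; apply: measurable_funX; apply: measurable_funB => //.
exact: measurable_rV_coord.
Qed.

Lemma lebesgue_eball_le x r : 0 < r -> (L (eball x r) <= ((2 * r) ^+ n)%:E)%E.
Proof.
move=> r0.
pose B : set (borel_rV R n) := [set v : 'rV[R]_n | forall i,
  (v ord0 i \in `[(x - const_mx r) ord0 i, (x + const_mx r) ord0 i])].
have mB : measurable B.
  by apply: (@measurable_rV_box R n (fun i => [set` `[_, _]])) => i; exact: measurable_itv.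
apply: (@le_trans _ _ (L B)).
  apply: le_measure; rewrite ?inE//; first exact: measurable_eball.
  move=> y /= yr i; rewrite !mxE in_itv/= -ler_distl distrC.
  have := ler_coord_enorm (y - x) i; rewrite !mxE distrC => /le_trans; apply.
  exact: ltW.
rewrite lebesgue_rV_box => [|i]; last by rewrite !mxE; lra.
rewrite lee_fin (eq_bigr (fun=> 2 * r)) ?prodr_const ?card_ord// => i _.
by rewrite !mxE; ring.
Qed.

End euclidean_balls.

Section weight_maximal.
Context (R : realType) (n : nat) (n0 : (0 < n)%N) (S : R) (S0 : 0 < S).
Variables (mu : {measure set (borel_rV R n) -> \bar R}) (q : R) (q1 : 1 <= q).
Hypothesis mu_fin : forall i, (mu (@dcube R n S i) < +oo)%E.
Local Notation L := (lebesgue_rV R n).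

(** The power of 2 comes from the cube of side [2 * r] around a ball in [lebesgue_eball_le], the
    other factor from the radius [n.+1%:R * s]. *)
Definition maximal_const : R := 2 ^+ n * n.+1%:R ^+ n.-1.

Lemma maximal_const_gt0 : 0 < maximal_const.
Proof. by rewrite mulr_gt0// exprn_gt0. Qed.

(** Test the maximal function with a ball around [x] that contains the cube: there r^alpha / r^n is
    (r^(n-1))^(-q), and the power 1/q produces the weight. *)
Lemma weight_le_maximal i (x : 'rV[R]_n) : @dcube R n S i x ->
  ((weight S mu q i)%:E <= maximal_const%:E *
     maximal_function (n%:R - q * (n%:R - 1)) mu x `^ q^-1)%E.
Proof.
have q0 : 0 < q by exact: lt_le_trans ltr01 q1.
have := mu_fin i; rewrite /dcube /weight; case: pickle_inv => [[a m]|]//.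
set s := side S a; have s0 : 0 < s by exact: side_gt0.
set P := cube s m => Pfin xP.
have muP : mu P = (fine (mu P))%:E by rewrite fineK// ge0_fin_numE.
set p := fine (mu P) in muP *.
have p0 : 0 <= p by rewrite fine_ge0.
(* Points of [P] are at distance at most [n%:R * s]; one more [s] gives the strict inequality of an
   open ball. *)
pose r := n.+1%:R * s; have r0 : 0 < r by rewrite mulr_gt0.
have mP : measurable P by exact: measurable_cube.
have Pb : P `<=` eball x r.
  move=> y yP; rewrite /eball/=; apply: (@le_lt_trans _ _ (n%:R * s)).
    apply: enorm_le; first exact: ltW.
    by move=> j; rewrite !mxE ltW//; exact: (cube_dist j s0 yP xP).
  by rewrite ltr_pM2r// ltr_nat.
have mb := measurable_eball x r0.
have Lb0 : (0 < L (eball x r))%E.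
  apply: (@lt_le_trans _ _ (L P)); last by rewrite le_measure ?inE.
  by rewrite lebesgue_cube// lte_fin exprn_gt0.
pose A := p `^ q^-1; have A0 : 0 <= A by exact: powR_ge0.
pose B := r ^+ n.-1; have B0 : 0 < B by rewrite exprn_gt0.
pose z := r `^ (n%:R - q * (n%:R - 1)) * (p / (2 * r) ^+ n).
have zM : (z%:E <= maximal_function (n%:R - q * (n%:R - 1)) mu x)%E.
  apply: le_ereal_sup_tmp; eexists; first by exists r => //; reflexivity.
  rewrite EFinM; apply: lee_wpmul2l; first by rewrite lee_fin powR_ge0.
  rewrite EFinM -muP; apply: lee_pmul => //.
  - by rewrite lee_fin invr_ge0 exprn_ge0// mulr_ge0// ltW.
  - by rewrite le_measure ?inE.
  have := lebesgue_eball_le x r0; move: Lb0.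
  case: (L (eball x r)) => [l||]//; rewrite lte_fin lee_fin => l0 lr.
  by rewrite inver gt_eqF// lee_fin lef_pV2 ?posrE// exprn_gt0// mulr_gt0.
(* By [1 <= q], 2^n is at most its own [q]-th power, so the constant can be taken out of the
   root. *)
have zA : (A / B / 2 ^+ n) `^ q <= z.
  have AB0 : 0 <= A / B by rewrite divr_ge0// ltW.
  have p20 : 0 < (2 : R) ^+ n by rewrite exprn_gt0.
  rewrite powR_divr// powR_divr// -[A `^ q]powRrM mulVf ?gt_eqF// powRr1//.
  have -> : z = p / B `^ q / 2 ^+ n.
    have nE : n%:R - 1 = n.-1%:R :> R by rewrite -[in LHS](prednK n0) -natr1 addrK.
    have r20 : r ^+ n != 0 by rewrite expf_neq0// gt_eqF.
    rewrite /z /B nE powRB; last by rewrite (gt_eqF r0) implybT.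
    rewrite powR_mulrn ?ltW// mulrC [q * _]mulrC powRrM powR_mulrn ?ltW// exprMn.
    have Bq0 : (r ^+ n.-1) `^ q != 0 by rewrite gt_eqF// powR_gt0.
    move: r20 Bq0 p20; move: (r ^+ n) ((r ^+ n.-1) `^ q) (2 ^+ n) => b c d b0 c0 d0.
    by field; rewrite b0 c0 gt_eqF.
  apply: ler_wpM2l; first by rewrite mulr_ge0// invr_ge0 powR_ge0.
  rewrite lef_pV2 ?posrE ?powR_gt0//; apply: le1r_powR => //.
  by rewrite exprn_ege1// ler1n.
have -> : p `^ q^-1 / s ^+ n.-1 = maximal_const * (A / B / 2 ^+ n).
  have -> : B = n.+1%:R ^+ n.-1 * s ^+ n.-1 by rewrite /B /r exprMn.
  rewrite /maximal_const -/A.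
  have p20 : (2 : R) ^+ n != 0 by rewrite expf_neq0.
  have N0 : (n.+1%:R : R) ^+ n.-1 != 0 by rewrite expf_neq0// pnatr_eq0.
  have sn0 : s ^+ n.-1 != 0 by rewrite expf_neq0// gt_eqF.
  move: p20 N0 sn0; move: (_ ^+ n) (_ ^+ n.-1) (_ ^+ n.-1) => b c d b0 c0 d0.
  by field; rewrite b0 c0 d0.
rewrite EFinM; apply: lee_wpmul2l; first by rewrite lee_fin ltW// maximal_const_gt0.
have ABn0 : 0 <= A / B / 2 ^+ n by rewrite !divr_ge0// ?exprn_ge0// ltW.
rewrite -[leLHS](poweRKV (q := q)) ?gt_eqF ?lee_fin//.
have ABz : (((A / B / 2 ^+ n) `^ q)%:E <= maximal_function (n%:R - q * (n%:R - 1)) mu x)%E.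
  by apply: le_trans zM; rewrite lee_fin.
apply: gt0_ler_poweR ABz; first by rewrite invr_ge0 ltW.
- by rewrite in_itv/= leey andbT lee_fin powR_ge0.
- rewrite in_itv/= leey andbT; apply: le_trans zM.
  by rewrite lee_fin (le_trans _ zA)// powR_ge0.
Qed.

End weight_maximal.

(** * Level sets and a discrete coarea formula *)

Section level_sets.
Context (R : realType) (n : nat) (u : 'rV[R]_n -> R) (k : R).
Hypotheses (k0 : 0 <= k) (uk : elipschitz k u).
Implicit Types (x y v : 'rV[R]_n) (t h : R) (j : 'I_n).
Local Notation L := (lebesgue_rV R n).
Local Notation leb := (@lebesgue_measure R).

Definition level t : set (borel_rV R n) := [set x : 'rV[R]_n | t < `|u x|].

Let cu : continuous u. Proof. exact: elipschitz_continuous uk. Qed.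

Lemma open_level t : open (level t : set 'rV[R]_n).
Proof.
suff : open ((fun x : 'rV[R]_n => `|u x|) @^-1` [set s | t < s]) by [].
apply: open_comp; last exact: open_gt.
by move=> x _; apply: (@continuous_comp _ _ _ u Num.norm); [exact: cu|exact: norm_continuous].
Qed.

Lemma measurable_elipschitz : measurable_fun setT (u : borel_rV R n -> R).
Proof. exact: continuous_measurable_rV. Qed.

Lemma measurable_elipschitz_shift h j :
  measurable_fun setT (fun x : borel_rV R n => u ((x : 'rV[R]_n) + h *: delta_mx ord0 j)).
Proof.
have : continuous (fun x : 'rV[R]_n => u (x + h *: delta_mx ord0 j)).
  move=> x.
  have sh : y + h *: delta_mx ord0 j @[y --> x] --> x + h *: delta_mx ord0 j.
    exact: (cvgD cvg_id (cvg_cst _)).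
  apply: (@continuous_comp _ _ _ (fun y : 'rV[R]_n => y + h *: delta_mx ord0 j) u).
    exact: sh.
  exact: cu.
exact: continuous_measurable_rV.
Qed.

(** The sets [step_diff] of all levels are the sections of this one set, whose measurability in (t,
    x) Tonelli requires. *)
Let crossing h j : set (measurableTypeR R * borel_rV R n) :=
  [set p | (p.1 < `|u p.2|) != (p.1 < `|u ((p.2 : 'rV[R]_n) + h *: delta_mx ord0 j)|)].

Let crossingE h j t x : crossing h j (t, x) <-> step_diff h j (level t) x.
Proof.
rewrite /crossing /step_diff /=.
have inlevel y : (y \in level t) = (t < `|u y|) by apply/idP/idP => [/set_mem|?]//; exact/mem_set.
by rewrite !inlevel.
Qed.

Let measurable_crossing h j : measurable (crossing h j).
Proof.
have m1 : measurable_fun setT (fun p : measurableTypeR R * borel_rV R n => p.1 < `|u p.2|).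
  apply: measurable_fun_ltr; first exact: measurable_fst.
  by apply: measurableT_comp => //; apply: (measurableT_comp measurable_elipschitz); exact: measurable_snd.
have m2 : measurable_fun setT (fun p : measurableTypeR R * borel_rV R n =>
    p.1 < `|u ((p.2 : 'rV[R]_n) + h *: delta_mx ord0 j)|).
  apply: measurable_fun_ltr; first exact: measurable_fst.
  by apply: measurableT_comp => //; apply: (measurableT_comp (measurable_elipschitz_shift h j)); exact: measurable_snd.
pose A1 := (fun p : measurableTypeR R * borel_rV R n => p.1 < `|u p.2|) @^-1` [set true].
pose A2 := (fun p : measurableTypeR R * borel_rV R n =>
    p.1 < `|u ((p.2 : 'rV[R]_n) + h *: delta_mx ord0 j)|) @^-1` [set true].
have mA1 : measurable A1 by rewrite -[X in measurable X]setTI; exact: m1.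
have mA2 : measurable A2 by rewrite -[X in measurable X]setTI; exact: m2.
rewrite (_ : crossing h j = (A1 `\` A2) `|` (A2 `\` A1)).
  by apply: measurableU; exact: measurableD.
apply/seteqP; split=> p; rewrite /crossing /A1 /A2 /=.
  by case: (p.1 < _); case: (p.1 < _) => //= _; [left|right].
by case=> -[-> /negP/negbTE ->].
Qed.

Lemma lebesgue_between (a b : R) :
  leb [set t | (t < a) != (t < b)] = `|a - b|%:E.
Proof.
wlog ab : a b / a <= b.
  move=> H; have [/H//|/ltW ba] := leP a b.
  by rewrite distrC -(H b a ba); congr (leb _); apply/seteqP; split=> t /=; rewrite eq_sym.
rewrite (_ : [set t | _] = `[a, b[%classic).
  rewrite lebesgue_measure_itv/= lte_fin; case: ltP => [_|ba].
    by rewrite distrC ger0_norm ?subr_ge0// EFinB.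
  by rewrite (@le_anti _ _ a b) ?ab// subrr normr0.
apply/seteqP; split=> t /=; rewrite in_itv/=.
  by case: (ltP t a) => [ta|_] /=; [rewrite (lt_le_trans ta ab)|case: (t < b)].
by move=> /andP[+ ->]; rewrite leNgt => /negbTE ->.
Qed.

Section weighted.
Variable W : borel_rV R n -> R.
Hypotheses (W0 : forall x, 0 <= W x) (mW : measurable_fun setT W).

Let F h j (p : measurableTypeR R * borel_rV R n) : \bar R := (W p.2 * \1_(crossing h j) p)%:E.

Let F0 h j p : (0 <= F h j p)%E.
Proof. by rewrite lee_fin mulr_ge0. Qed.

Let mF h j : measurable_fun setT (F h j).
Proof.
apply/measurable_EFinP; apply: measurable_funM.
  by apply: (measurableT_comp mW); exact: measurable_snd.
by apply: measurable_indic; exact: measurable_crossing.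
Qed.

Let FE h j t : (\int[L]_x F h j (t, x) = \int[L]_x (W x * \1_(step_diff h j (level t)) x)%:E)%E.
Proof.
apply: eq_integral => x _; rewrite /F/= !indicE; congr (_ * _%:R)%:E; congr nat_of_bool.
by apply/idP/idP => /set_mem H; apply/mem_set; apply/crossingE.
Qed.

Lemma measurable_integral_step_diff h j : measurable_fun [set: measurableTypeR R]
  (fun t => \int[L]_x (W x * \1_(step_diff h j (level t)) x)%:E)%E.
Proof.
have := @measurable_fun_fubini_tonelli_F _ _ _ _ _ L _ (mF h j) (F0 h j).
by rewrite /fubini_F; under eq_fun do rewrite FE.
Qed.

(** Exchange the integrals: for fixed [x] the levels separating the two values of |u| form an
    interval, measured by [lebesgue_between]. *)
Lemma integral_step_diff h j :
  (\int[leb]_t \int[L]_x (W x * \1_(step_diff h j (level t)) x)%:E =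
   \int[L]_x (W x * `| `|u x| - `|u ((x : 'rV[R]_n) + h *: delta_mx ord0 j)| |)%:E)%E.
Proof.
under eq_integral do rewrite -FE.
rewrite (@fubini_tonelli _ _ _ _ _ leb L _ (mF h j) (F0 h j)).
apply: eq_integral => x _; rewrite /F /=.
have mx : measurable ([set t | (t < `|u x|) != (t < `|u ((x : 'rV[R]_n) + h *: delta_mx ord0 j)|)] : set (measurableTypeR R)).
  have := measurable_ysection x (measurable_crossing h j).
  rewrite (_ : ysection _ _ = [set t | (t < `|u x|) != (t < `|u ((x : 'rV[R]_n) + h *: delta_mx ord0 j)|)])//.
  by apply/seteqP; split=> t; rewrite /ysection/= inE.
rewrite EFinM -lebesgue_between -(setIT [set t | _ != _]) -integral_indic//.
rewrite -ge0_integralZl_EFin//.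
by apply/measurable_EFinP; exact: measurable_indic.
Qed.

End weighted.
End level_sets.

(** * The limit of the difference quotients *)

Section difference_quotients.
Context (R : realType) (n : nat) (S : R) (S0 : 0 < S).
Variables (u : 'rV[R]_n -> R) (k : R).
Hypotheses (k0 : 0 <= k) (uk : elipschitz k u).
Implicit Types (x y v : 'rV[R]_n) (j : 'I_n).
Local Notation L := (lebesgue_rV R n).
Local Notation leb := (@lebesgue_measure R).
Local Notation side := (side S).

Lemma cvg_side : side i @[i --> \oo] --> (0 : R).
Proof.
have := @cvg_geometric R S 2^-1.
rewrite ger0_norm ?invr_ge0// invf_lt1// ltr1n => /(_ isT).
by rewrite /geometric /=; under eq_fun do rewrite exprVn.
Qed.

Let cu : continuous u. Proof. exact: elipschitz_continuous uk. Qed.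

Let quotient i j x := `|(side i)^-1 * (u (x + side i *: delta_mx ord0 j) - u x)|.

Let measurable_quotient i j : measurable_fun setT (quotient i j : borel_rV R n -> R).
Proof.
apply: measurableT_comp => //; apply: measurable_funM => //; apply: measurable_funB.
  have : continuous (fun x : 'rV[R]_n => u (x + side i *: delta_mx ord0 j)).
    move=> x; apply: (@continuous_comp _ _ _ (fun y : 'rV[R]_n => y + side i *: delta_mx ord0 j) u).
      exact: (cvgD cvg_id (cvg_cst _)).
    exact: cu.
  exact: continuous_measurable_rV.
exact: continuous_measurable_rV.
Qed.

Let quotient_le i j x : quotient i j x <= k.
Proof.
rewrite /quotient normrM ger0_norm ?invr_ge0 ?(ltW (side_gt0 S0 i))//.
rewrite ler_pdivrMl ?side_gt0//; apply: (le_trans (uk _ _)).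
by rewrite addrAC subrr add0r enorm_delta gtr0_norm ?side_gt0// mulrC.
Qed.

Let quotient_cvg j x : derivable u x (delta_mx ord0 j) ->
  quotient i j x @[i --> \oo] --> `|'D_(delta_mx ord0 j) u x|.
Proof.
move=> du; have c0 : side i @[i --> \oo] --> (0 : R)^'.
  move=> A [/= e e0 Ae]; have /(@cvgrPdist_lt _ R^o)/(_ e e0) := cvg_side.
  apply: filterS => i ie; apply: Ae; first exact: ie.
  by rewrite gt_eqF// side_gt0.
have cq := cvg_comp _ _ c0 du.
rewrite (_ : quotient ^~ j ^~ x = fun i => `|(side i)^-1 *: ((u \o shift x) (side i *: delta_mx ord0 j) - u x)|).
  exact: (cvg_norm cq).
by apply/funext => i; rewrite /quotient /= [side i *: _ + x]addrC.
Qed.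

Variable W : borel_rV R n -> R.
Hypotheses (W0 : forall x, 0 <= W x) (mW : measurable_fun setT W).
Hypothesis iW : L.-integrable setT (EFin \o W).

(** The quotients are at most [k] and converge almost everywhere to the partial derivatives in
    absolute value, so dominated convergence applies with bound [n%:R * k] times [W]. Only pointwise
    comparison is available for the arbitrary [g]. *)
Lemma limn_einf_diff_quotient (g : borel_rV R n -> \bar R) :
  (forall x : 'rV[R]_n, (W x * \sum_j `|'D_(delta_mx ord0 j) u x|)%:E <= g x)%E ->
  (limn_einf (fun i => \int[L]_x (W x * \sum_j (side i)^-1 *
     `| `|u x| - `|u ((x : 'rV[R]_n) + side i *: delta_mx ord0 j)| |)%:E)
   <= \int[L]_x g x)%E.
Proof.
move=> gD.
pose f_ i (x : borel_rV R n) : \bar R := (W x * \sum_j quotient i j x)%:E.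
(* The upper limit is measurable and defined everywhere; it is the true limit where all partial
   derivatives exist. *)
pose f (x : borel_rV R n) : \bar R := limn_esup (f_ ^~ x).
have q0 i j x : 0 <= quotient i j x by rewrite /quotient.
have f0 i x : (0 <= f_ i x)%E by rewrite lee_fin mulr_ge0// sumr_ge0.
have mf_ i : measurable_fun setT (f_ i).
  by apply/measurable_EFinP; apply: measurable_funM => //; exact: measurable_sum.
have mf : measurable_fun setT f by exact: measurable_fun_limn_esup.
have ae_der : {ae L, forall x, forall j, derivable u x (delta_mx ord0 j)}.
  have : {ae L, forall x, forall (m : nat) (j : 'I_n), j = m :> nat -> derivable u x (delta_mx ord0 j)}.
    apply/ae_foralln => m; have [mn|mn] := ltnP m n; last first.
      by apply: aeW => x j jm; move: mn; rewrite -jm leqNgt ltn_ord.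
    have FF := ae_filter_ringOfSetsType L.
    apply: filterS (partial_derivable_ae (Ordinal mn) uk) => x dx j jm.
    by rewrite (_ : j = Ordinal mn)//; exact: val_inj.
  by apply: filterS; [exact: (ae_filter_ringOfSetsType L)|move=> x dx j; exact: (dx j)].
have cvg_f x : (forall j, derivable u x (delta_mx ord0 j)) ->
    f_ ^~ x @ \oo --> (W x * \sum_j `|'D_(delta_mx ord0 j) u x|)%:E.
  move=> dx; apply: cvg_EFin; first by apply: nearW.
  apply: cvgM; first exact: cvg_cst.
  elim: (index_enum _) => [|j s IH].
    by under eq_fun do rewrite big_nil; rewrite big_nil; exact: cvg_cst.
  by under eq_fun do rewrite big_cons; rewrite big_cons; apply: cvgD => //; exact: quotient_cvg.
have fE x : (forall j, derivable u x (delta_mx ord0 j)) ->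
    f x = (W x * \sum_j `|'D_(delta_mx ord0 j) u x|)%:E.
  move=> /cvg_f fx; rewrite /f is_cvg_limn_esupE; first exact/cvg_lim.
  by apply/cvg_ex; eexists; exact: fx.
have [N [mN N0 derN]] := ae_der.
have derNC x : ~ N x -> forall j, derivable u x (delta_mx ord0 j).
  by move=> Nx; apply: contrapT => nd; apply/Nx/derN.
pose G (x : borel_rV R n) : \bar R := ((n%:R * k)%:E * (W x)%:E)%E.
have [_ _ cvgI] : [/\ L.-integrable setT f,
  [sequence \int[L]_x `|f_ i x - f x| ]_i%E @ \oo --> 0%E &
  [sequence \int[L]_x (f_ i x) ]_i%E @ \oo --> (\int[L]_x f x)%E].
  apply: (@dominated_convergence _ _ _ L setT measurableT f_ f G) => //.
  - have FF := ae_filter_ringOfSetsType L.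
    by apply: filterS ae_der => x dx _; rewrite fE//; exact: cvg_f.
  - exact: integrableZl.
  - apply/aeW => x i _; rewrite gee0_abs// /G -EFinM lee_fin mulrC ler_wpM2r//.
    by rewrite mulr_natl -[X in _ *+ X]card_ord -sumr_const ler_sum.
apply: (@le_trans _ _ (\int[L]_x f x)%E).
  rewrite -(cvg_lim _ cvgI)// limn_einf_lim; apply: lee_lim.
  - exact: is_cvg_einfs.
  - by apply/cvg_ex; eexists; exact: cvgI.
  apply: nearW => i; apply: (@le_trans _ _ (\int[L]_x (W x * \sum_j (side i)^-1 *
     `| `|u x| - `|u ((x : 'rV[R]_n) + side i *: delta_mx ord0 j)| |)%:E)%E).
    by apply: ereal_inf_lbound; exists i => /=.
  have i0 : 0 <= (side i)^-1 by rewrite invr_ge0 ltW// side_gt0.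
  apply: ge0_le_integralT => x.
    by rewrite lee_fin mulr_ge0// sumr_ge0// => j _; rewrite mulr_ge0.
  rewrite lee_fin ler_wpM2l//; apply: ler_sum => j _; rewrite /quotient normrM (ger0_norm i0).
  by rewrite ler_wpM2l// distrC; exact: ler_dist_dist.
(* The null set [N] is removed on the side of the measurable [f]; what remains is 0 on [N], hence
   below [g] everywhere. *)
rewrite (@ge0_negligible_integral _ _ _ L setT N)//; last first.
  move=> x _; rewrite /f limn_esup_lim; apply: lime_ge; first exact: is_cvg_esups.
  by apply: nearW => i; apply: le_trans (f0 i x) _; apply: ereal_sup_ubound; exists i => /=.
rewrite integral_mkcond; apply: ge0_le_integralT => x.
  rewrite /patch; case: ifPn => // /set_mem[_ Nx]; rewrite fE; last exact: derNC.
  by rewrite lee_fin mulr_ge0// sumr_ge0.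
have g0 : (0 <= g x)%E by apply: le_trans (gD x); rewrite lee_fin mulr_ge0// sumr_ge0.
rewrite /patch; case: ifPn => // /set_mem[_ Nx]; rewrite fE; last exact: derNC.
exact: gD.
Qed.

End difference_quotients.

(** * Integration over the levels *)

Section capacitary_bound.
Context (R : realType) (n : nat) (n0 : (0 < n)%N).
Variables (mu : {measure set (borel_rV R n) -> \bar R}) (q : R) (q1 : 1 <= q).
Hypothesis mu_lf : locally_finite mu.
Implicit Types (x y : 'rV[R]_n) (j : 'I_n).
Local Notation L := (lebesgue_rV R n).
Local Notation leb := (@lebesgue_measure R).

Lemma locally_finite_dcube (S : R) i : 0 < S -> (mu (dcube S i) < +oo)%E.
Proof.
move=> S0; rewrite /dcube; case: pickle_inv => [[a m]|]; last by rewrite measure0.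
have s0 := side_gt0 S0 a.
pose K : set 'rV[R]_n := [set v : 'rV[R]_n | forall l,
  [set` `[(m l)%:~R * side S a, (m l + 1)%:~R * side S a]] (v ord0 l)].
have cK : compact K by apply: (@rV_compact _ n (fun l => [set` _])) => l; exact: segment_compact.
apply: le_lt_trans (mu_lf cK); apply: le_measure; rewrite ?inE.
- exact: measurable_cube.
- by apply: (@measurable_rV_box R n (fun l => [set` `[_, _]])) => l; exact: measurable_itv.
- rewrite cubeE// => y /= ym l; have := ym l; rewrite !in_itv/= => /andP[ym1 /ltW ym2].
  exact/andP.
Qed.

Lemma integrable_maxweight (S : R) N : 0 < S ->
  L.-integrable setT (EFin \o maxweight S mu q N).
Proof.
move=> S0.
pose g (x : borel_rV R n) : \bar R := (\sum_(i < N) (weight S mu q i)%:E * (\1_(dcube S i) x)%:E)%E.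
have w0 i : 0 <= weight S mu q i by exact: weight_ge0.
apply: (@le_integrable _ _ _ L setT measurableT _ g).
- by apply/measurable_EFinP; exact: measurable_maxweight.
- move=> x _; rewrite /g /= ger0_norm ?maxweight_ge0//.
  rewrite gee0_abs; last by apply: sume_ge0 => i _; rewrite mule_ge0// lee_fin.
  under eq_bigr do rewrite -EFinM; rewrite sumEFin lee_fin; apply: bigmax_le.
    by apply: sumr_ge0 => i _; rewrite mulr_ge0.
  by move=> i _; rewrite (bigD1 i)//= lerDl sumr_ge0// => l _; rewrite mulr_ge0.
- apply: integrable_sum => // i _; apply: integrableZl => //.
  have mi := measurable_dcube S0 i.
  apply/integrableP; split; first by apply/measurable_EFinP; exact: measurable_indic.
  under eq_integral do rewrite gee0_abs ?lee_fin//.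
  rewrite integral_indic// setIT /dcube; case: pickle_inv => [[a m]|]; last by rewrite measure0.
  by rewrite [X in (X < _)%E](lebesgue_cube m (side_gt0 S0 a)) ltry.
Qed.

Variables (u : 'rV[R]_n -> R) (k : R).
Hypotheses (k0 : 0 <= k) (uk : elipschitz k u).
Variable b : R.
Hypotheses (b0 : 0 < b) (ub : forall x, u x != 0 -> forall j, `|x ord0 j| <= b).
(** [u] vanishes outside a box of volume (2b)^n, that is (S/2)^n, which is at most half a cube of
    side [S]; so no cube of level 0 is more than half full. *)
Let S := 4 * b.
Let S0 : 0 < S. Proof. by rewrite mulr_gt0. Qed.

Let level_top t m : 0 <= t ->
  (L (cube (side S 0) m `&` level u t) <= (side S 0 ^+ n / 2)%:E)%E.
Proof.
move=> t0; have mE : measurable (level u t) by apply: open_measurable_rV; exact: open_level uk _.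
pose B : set (borel_rV R n) := [set v : 'rV[R]_n | forall i,
  (v ord0 i \in `[(const_mx (- b) : 'rV[R]_n) ord0 i, (const_mx b : 'rV[R]_n) ord0 i])].
have mB : measurable B.
  by apply: (@measurable_rV_box R n (fun i => [set` `[_, _]])) => i; exact: measurable_itv.
apply: (@le_trans _ _ (L B)).
  apply: le_measure; rewrite ?inE//.
    by apply: measurableI => //; apply: measurable_cube; exact: side_gt0.
  move=> x [_ xt] i; rewrite !mxE in_itv/= -ler_norml; apply: ub.
  by rewrite -normr_gt0; exact: le_lt_trans xt.
rewrite lebesgue_rV_box => [|i]; last first.
  by rewrite !mxE (le_trans _ (ltW b0))// oppr_le0 ltW.
rewrite lee_fin (eq_bigr (fun=> b + b)) => [|i _]; last by rewrite !mxE opprK.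
rewrite prodr_const card_ord /side expr0 divr1 /S (_ : 4 * b = 2 * (b + b)); last by ring.
rewrite exprMn mulrAC -[leLHS]mul1r ler_pM2r; last by rewrite exprn_gt0// addr_gt0.
by rewrite -(prednK n0) exprSr mulfK// exprn_ege1// ler1n.
Qed.

Let W N := maxweight S mu q N : borel_rV R n -> R.
Let H N i t : \bar R := ((2 ^+ n.+3)%:E * ((side S i)^-1%:E * \sum_(j < n)
     \int[L]_x (W N x * \1_(step_diff (side S i) j (level u t)) x)%:E))%E.

Let W0 N x : 0 <= W N x. Proof. exact: maxweight_ge0. Qed.
Let mW N : measurable_fun setT (W N). Proof. exact: measurable_maxweight. Qed.

Let I0 N i j t : (0 <= \int[L]_x (W N x * \1_(step_diff (side S i) j (level u t)) x)%:E)%E.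
Proof. by apply: integral_ge0 => x _; rewrite lee_fin mulr_ge0. Qed.

Let mI N i j : measurable_fun [set: measurableTypeR R]
  (fun t => \int[L]_x (W N x * \1_(step_diff (side S i) j (level u t)) x)%:E)%E.
Proof. exact: (measurable_integral_step_diff k0 uk (W0 N) (mW N)). Qed.

Let h0 i : 0 <= (side S i)^-1. Proof. by rewrite invr_ge0 ltW// side_gt0. Qed.

Let H0 N i t : (0 <= H N i t)%E.
Proof. by rewrite !mule_ge0 ?lee_fin ?exprn_ge0// sume_ge0. Qed.

Let mH N i : measurable_fun [set: measurableTypeR R] (H N i).
Proof.
by apply: measurable_funeM; apply: measurable_funeM; exact: emeasurable_sum.
Qed.

(** For fixed [N] and [t] the bound by [H] holds from some scale on, and a lower limit in [i]
    ignores the rest. The partial sums over selected cubes increase with [N], so the outer lower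
    limit dominates the whole series. *)
Let level_poweR_le t : 0 < t ->
  (mu (level u t) `^ q^-1 <= limn_einf (fun N => limn_einf (fun i => H N i t)))%E.
Proof.
move=> t0; have oE := @open_level _ _ _ _ k0 uk t.
have mE : measurable (level u t) by exact: open_measurable_rV.
apply: le_trans (poweRV_measure_le mu q1 mE (measurable_dcube S0) (selected_cover S0 oE (fun m => level_top m (ltW t0)))) _.
rewrite limn_einf_lim.
set a := (fun N => \sum_(0 <= i < N | selected S (level u t) i) mu (dcube S i) `^ q^-1)%E.
have nda : nondecreasing_seq a.
  by move=> N M NM; apply: lee_sum_nneg_natr => // i _ _; exact: poweR_ge0.
apply: lee_lim; [exact: ereal_nondecreasing_is_cvgn|exact: is_cvg_einfs|].
apply: nearW => N; apply: le_ereal_inf_tmp => _ [M /= NM <-].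
apply: (le_trans (nda _ _ NM)); apply: limn_einf_ge.
exact: (selected_bound n0 S0 (fun i => locally_finite_dcube i S0) M q1 oE).
Qed.

(** Fatou's lemma is applied in [N] and then in the scale, after which the difference quotients
    converge at fixed [N]. The bound [g] is common to all [N], so the lower limit in [N] stays below
    it. *)
Lemma level_integral_le (g : borel_rV R n -> \bar R) :
  (forall N x, (W N x * \sum_j `|'D_(delta_mx ord0 j) u x|)%:E <= g x)%E ->
  (\int[leb]_(t in `]0%R, +oo[) (mu (level u t) `^ q^-1) <=
   (2 ^+ n.+3)%:E * \int[L]_x g x)%E.
Proof.
move=> Wg.
apply: (@le_trans _ _ (\int[leb]_t limn_einf (fun N => limn_einf (fun i => H N i t)))%E).
  rewrite integral_mkcond; apply: ge0_le_integralT => t.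
    by rewrite /patch; case: ifP => // _; exact: poweR_ge0.
  rewrite /patch; case: ifPn => [/set_mem/=|_].
    by rewrite in_itv/= andbT => t0; exact: level_poweR_le.
  apply: limn_einf_ge; exists 0%N => N _; apply: limn_einf_ge; by exists 0%N.
have liminf0 N t : (0 <= limn_einf (fun i => H N i t))%E by apply: limn_einf_ge; exists 0%N.
have mliminf N : measurable_fun [set: measurableTypeR R] (fun t => limn_einf (fun i => H N i t)).
  rewrite /limn_einf; apply: measurableT_comp => //.
  by apply: measurable_fun_limn_esup => i; apply: measurableT_comp => //; exact: mH.
apply: le_trans (fatou leb measurableT mliminf (fun N t _ => liminf0 N t)) _.
apply: limn_einf_le => N.
apply: le_trans (fatou leb measurableT (mH N) (fun i t _ => H0 N i t)) _.
pose c : R := 2 ^+ n.+3; have c0 : 0 < c by rewrite exprn_gt0.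
pose d i j (x : borel_rV R n) : R := `| `|u x| - `|u ((x : 'rV[R]_n) + side S i *: delta_mx ord0 j)| |.
have md i j : measurable_fun setT (fun x : borel_rV R n => (W N x * d i j x)%:E : \bar R).
  apply/measurable_EFinP; apply: measurable_funM => //; apply: measurableT_comp => //.
  apply: measurable_funB; apply: measurableT_comp => //.
    exact: (measurable_elipschitz k0 uk).
  exact: (measurable_elipschitz_shift k0 uk).
have d0 i j x : (0 <= (W N x * d i j x)%:E)%E by rewrite lee_fin mulr_ge0 // /d.
(* The discrete coarea formula turns the crossings of all levels into differences of |u|, under a
   single integral in [x]. *)
have HE i : (\int[leb]_t H N i t = \int[L]_x (c * W N x * \sum_j (side S i)^-1 * d i j x)%:E)%E.
  have -> : (\int[leb]_t H N i t = c%:E * ((side S i)^-1%:E * \sum_(j < n) \int[L]_x (W N x * d i j x)%:E))%E.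
    have mS : measurable_fun [set: measurableTypeR R] (fun t => \sum_(j < n)
        \int[L]_x (W N x * \1_(step_diff (side S i) j (level u t)) x)%:E)%E.
      exact: emeasurable_sum.
    transitivity (c%:E * \int[leb]_t ((side S i)^-1%:E * \sum_(j < n)
        \int[L]_x (W N x * \1_(step_diff (side S i) j (level u t)) x)%:E))%E.
      apply: ge0_integralZl_EFin => //.
        by move=> t _; rewrite mule_ge0 ?lee_fin// sume_ge0.
      exact: measurable_funeM.
    congr (_ * _)%E.
    transitivity ((side S i)^-1%:E * \int[leb]_t (\sum_(j < n)
        \int[L]_x (W N x * \1_(step_diff (side S i) j (level u t)) x)%:E))%E.
      by apply: ge0_integralZl_EFin => // t _; rewrite sume_ge0.
    rewrite ge0_integral_sum//; congr (_ * _)%E; apply: eq_bigr => j _.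
    exact: (integral_step_diff k0 uk (W0 N) (mW N)).
  have md' : measurable_fun setT (fun x : borel_rV R n => \sum_(j < n) (W N x * d i j x)%:E)%E by exact: emeasurable_sum.
  transitivity (\int[L]_x (c%:E * ((side S i)^-1%:E * \sum_(j < n) (W N x * d i j x)%:E)))%E; last first.
    apply: eq_integral => x _; rewrite sumEFin -!EFinM; congr (_%:E).
    by rewrite !mulr_sumr; apply: eq_bigr => j _; ring.
  apply/esym; transitivity (c%:E * \int[L]_x ((side S i)^-1%:E * \sum_(j < n) (W N x * d i j x)%:E))%E.
    apply: ge0_integralZl_EFin => //.
    - by move=> x _; rewrite mule_ge0 ?lee_fin// sume_ge0.
    - exact: measurable_funeM.
    - exact: ltW.
  congr (_ * _)%E.
  transitivity ((side S i)^-1%:E * \int[L]_x (\sum_(j < n) (W N x * d i j x)%:E))%E.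
    by apply: ge0_integralZl_EFin => // x _; rewrite sume_ge0.
  by rewrite ge0_integral_sum.
under [X in (limn_einf X <= _)%E]eq_fun do rewrite HE.
have g0 x : (0 <= g x)%E.
  by apply: le_trans (Wg N x); rewrite lee_fin mulr_ge0// sumr_ge0.
(* The constant is moved under the integral, so that the limit is taken with weight [c * W N] and
   bound [c * g]. *)
apply: le_trans (ge0_integralZl_leT L c0 g0).
apply: (limn_einf_diff_quotient S0 k0 uk).
- by move=> x; rewrite mulr_ge0// ltW.
- exact: measurable_funM.
- by have := integrableZl measurableT c (integrable_maxweight N S0); under eq_fun do rewrite -EFinM.
- move=> x; rewrite -mulrA EFinM; apply: lee_wpmul2l; first by rewrite lee_fin ltW.
  exact: Wg.
Qed.

End capacitary_bound.

(** * From the weights to the maximal function, and the final constant *)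

Lemma maxweight_le_maximal (R : realType) (n : nat) (n0 : (0 < n)%N) (S : R) (S0 : 0 < S)
    (mu : {measure set (borel_rV R n) -> \bar R}) (q : R) (q1 : 1 <= q)
    (mu_fin : forall i, (mu (dcube S i) < +oo)%E) (N : nat) (x : 'rV[R]_n) :
  ((maxweight S mu q N x)%:E <= (maximal_const R n)%:E *
     maximal_function (n%:R - q * (n%:R - 1)) mu x `^ q^-1)%E.
Proof.
have M0 : (0 <= (maximal_const R n)%:E *
     maximal_function (n%:R - q * (n%:R - 1)) mu x `^ q^-1)%E.
  by rewrite mule_ge0 ?poweR_ge0// lee_fin ltW// maximal_const_gt0.
rewrite /maxweight; elim/big_rec: _ => // i y _ yM.
rewrite EFin_max ge_max yM andbT indicE.
have [/set_mem xi|_] := boolP (x \in _); last by rewrite mulr0.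
by rewrite mulr1; exact: weight_le_maximal.
Qed.

Lemma compact_coord_bounded (R : realType) (n : nat) (K : set 'rV[R]_n) : compact K ->
  exists2 b : R, 0 < b & forall x, K x -> forall j, `|x ord0 j| <= b.
Proof.
move=> /compact_bounded[M [_ MK]]; exists (Num.max 0 M + 1).
  by rewrite ltr_pwDr// le_max lexx.
move=> x Kx j; apply: le_trans (MK (Num.max 0 M + 1) _ x Kx).
  rewrite [leRHS]/Num.Def.normr/= mx_normrE.
  exact: (le_bigmax _ (fun ij : 'I_1 * 'I_n => `|x ij.1 ij.2|) (ord0, j)).
by rewrite ltr_pwDr// le_max lexx orbT.
Qed.

Theorem corollary2p12 (R : realType) (n : nat) (q alpha : R)
    (hn : (2 <= n)%N) (hq1 : 1 <= q) (hqn : q <= n%:R / (n%:R - 1))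
    (halpha : alpha = n%:R - q * (n%:R - 1)) :
  exists2 C : R, 0 < C &
    forall (mu : {measure set (borel_rV R n) -> \bar R}) (u : 'rV[R]_n -> R),
      locally_finite mu -> Lipc u ->
      (lorentz_norm1 mu q u <=
       C%:E * \int[lebesgue_rV R n]_x
                ((enorm (gradient u x))%:E *
                 maximal_function alpha mu x `^ q^-1))%E.
Proof.
have n0 : (0 < n)%N by exact: leq_trans hn.
have q0 : 0 < q by exact: lt_le_trans ltr01 hq1.
have m0 := maximal_const_gt0 R n.
have nm0 : 0 < n%:R * maximal_const R n by apply: mulr_gt0 => //; rewrite ltr0n.
(* [q] is the factor in the Lorentz norm, 2^(n+3) comes from [isoperimetry], [n%:R] from bounding
   each partial derivative by the Euclidean norm of the gradient, and [maximal_const] from the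
   weights. *)
exists (q * (2 ^+ n.+3 * (n%:R * maximal_const R n))).
  by apply: mulr_gt0 => //; apply: mulr_gt0 => //; exact: exprn_gt0.
move=> mu u mu_lf [[k uk] csupp]; rewrite halpha.
have k0 := elipschitz_ge0 (Ordinal n0) uk.
have [b b0 ub] := compact_coord_bounded csupp.
have {}ub (x : 'rV[R]_n) : u x != 0 -> forall j, `|x ord0 j| <= b.
  by move=> ux; apply: ub; exact: subset_closure.
rewrite /lorentz_norm1.
set G := (X in (_ <= _ * \int[_]_x X x)%E).
have G0 x : (0 <= G x)%E by rewrite mule_ge0 ?poweR_ge0// lee_fin sqrtr_ge0.
rewrite EFinM -muleA; apply: lee_wpmul2l; first by rewrite lee_fin ltW.
pose g x := ((n%:R * maximal_const R n)%:E * G x)%E.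
apply: (@le_trans _ _ ((2 ^+ n.+3)%:E * \int[lebesgue_rV R n]_x g x)%E).
  apply: (level_integral_le n0 hq1 mu_lf k0 uk b0 ub) => N x.
  apply: (@le_trans _ _ ((maxweight (4 * b) mu q N x)%:E * (n%:R * enorm (gradient u x))%:E)%E).
    rewrite -EFinM lee_fin ler_wpM2l ?maxweight_ge0 ?mulr_gt0//.
    rewrite mulr_natl -[X in _ *+ X]card_ord -sumr_const; apply: ler_sum => j _.
    by have := ler_coord_enorm (gradient u x) j; rewrite mxE.
  have S0 : 0 < 4 * b by rewrite mulr_gt0.
  have := maxweight_le_maximal n0 S0 hq1 (fun i => locally_finite_dcube mu_lf i S0) N x.
  move=> /(lee_wpmul2r (x := (n%:R * enorm (gradient u x))%:E)) h.
  apply: le_trans (h _) _; first by rewrite lee_fin mulr_ge0// sqrtr_ge0.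
  rewrite /g /G; set X := (maximal_function _ _ _ `^ _)%E.
  rewrite (EFinM n%:R (enorm (gradient u x))) muleACA -EFinM [maximal_const R n * _]mulrC.
  by rewrite [(X * _)%E]muleC lexx.
rewrite [in leRHS]EFinM -muleA; apply: lee_wpmul2l; first by rewrite lee_fin exprn_ge0.
exact: ge0_integralZl_leT.
Qed.
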